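(* Let $N\in[1,\infty)$ and let $(X,d,m)$ be a noncompact $\mathrm{RCD}(0,N)$ space. Let $\gamma:[0,\infty)\to X$ be a geodesic ray, $p=\gamma(0)$, let $b$ be the Busemann function associated to $\gamma$, and suppose that $(X,d,m)$ has minimal volume growth, i.e. $$\limsup_{R\to\infty}\frac{m(B_p(R))}{R}=V_0<\infty .$$ Then the diameter of the level sets $b^{-1}(r)$ grows at most linearly. More precisely, there is a constant $C_0\le 2$ such that $$\limsup_{R\to+\infty}\frac{\mathrm{diam}(b^{-1}(R))}{R}\le C_0\le 2,$$ where the diameter of $b^{-1}(R)$ is computed with respect to $d$. In particular, $b^{-1}(r)$ is compact for every $r$.
   Context: A metric measure space $(X,d,m)$ means: $(X,d)$ is a complete separable geodesic metric space, $m$ is a nonnegative Radon measure, finite on bounded sets, with $\mathrm{supp}(m)=X$. Sobolev space: a test plan is a Borel probability measure $\pi$ on $C([0,1],X)$ such that $(e_t)_*\pi\le Cm$ for some $C>0$ and all $t\in[0,1]$ (where $e_t(\eta)=\eta_t$) and $\int\int_0^1|\dot\eta_t|^2dt\,d\pi(\eta)<\infty$ (the inner integral is $+\infty$ if $\eta$ is not absolutely continuous). $S^2(X)$ is the set of Borel $f:X\to\mathbb R$ for which there is a nonnegative $G\in L^2(X)$ with $\int|f(\eta_1)-f(\eta_0)|d\pi\le\int\int_0^1G(\eta_t)|\dot\eta_t|dt\,d\pi$ for all test plans $\pi$; the $m$-a.e. minimal such $G$ is denoted $|Df|$. $W^{1,2}(X)=L^2(X)\cap S^2(X)$ with $\|f\|_{W^{1,2}}^2=\|f\|_{L^2}^2+\||Df|\|_{L^2}^2$.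 The space is infinitesimally Hilbertian if $W^{1,2}(X)$ is a Hilbert space. $\mathrm{CD}(0,N)$, $N\in[1,\infty)$: for all $\mu_0=\rho_0m,\ \mu_1=\rho_1m$ in $\mathcal P_2(X)$ with bounded support there are an optimal coupling $\pi$ of $\mu_0,\mu_1$ for the cost $d^2$ and a geodesic $(\mu_t)_{t\in[0,1]}$ in $(\mathcal P_2(X),W_2)$ from $\mu_0$ to $\mu_1$ with $\mathcal U_{N'}(\mu_t)\le-\int[(1-t)\rho_0^{-1/N'}(x_0)+t\rho_1^{-1/N'}(x_1)]d\pi(x_0,x_1)$ for all $t\in[0,1]$, $N'\in[N,\infty)$, where for $\mu=\rho m+\mu^s$, $\mu^s\perp m$, $\mathcal U_{N'}(\mu)=-\int\rho^{1-1/N'}dm$ if $N'>1$ and $\mathcal U_1(\mu)=-m(\{\rho>0\})$. An $\mathrm{RCD}(0,N)$ space is an infinitesimally Hilbertian metric measure space satisfying $\mathrm{CD}(0,N)$. A geodesic ray is a map $\gamma:[0,\infty)\to X$ with $d(\gamma(s),\gamma(t))=|s-t|$ for all $s,t\ge0$. Its Busemann function is $b(x)=\lim_{t\to+\infty}(t-d(x,\gamma(t)))$. $B_p(R)$ is the ball of radius $R$ centred at $p$. *)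

(* Defs.v *)
From HB Require Import structures.
From mathcomp Require Import all_boot all_order all_algebra.
From mathcomp Require Import all_classical all_reals all_analysis.
Set Implicit Arguments.
Unset Strict Implicit.
Unset Printing Implicit Defensive.
Import Order.TTheory GRing.Theory Num.Theory.
Import numFieldNormedType.Exports.
Local Open Scope classical_set_scope.
Local Open Scope ring_scope.

(* The library's measurable types are pointed, so a metric measure space must
   carry a distinguished point here; it plays no role in the mathematics. *)
#[short(type="completePMetricType")]
HB.structure Definition CompletePMetric (R : numDomainType) :=
  {T of Metric R T & Uniform_isComplete T & isPointed T}.

Notation borel T := (g_sigma_algebraType (@open T)).

Section metric_space.
Context {R : realType} {X : completePMetricType R}.

Definition is_separable := exists2 D : set X, countable D & dense D.

Definition is_geodesic_space := forall x y : X, exists c : R -> X,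
  [/\ c 0 = x, c 1 = y &
      forall s t, 0 <= s <= 1 -> 0 <= t <= 1 ->
        mdist (c s) (c t) = `|s - t| * mdist x y].

Definition metric_bounded (A : set X) := exists x r, A `<=` ball x r.

(* The diameter of the empty set is 0. *)
Definition diam (A : set X) : \bar R :=
  ereal_sup ([set 0%E] `|` [set (mdist xy.1 xy.2)%:E | xy in A `*` A]).

Definition geodesic_ray (c : R -> X) :=
  forall s t, 0 <= s -> 0 <= t -> mdist (c s) (c t) = `|s - t|.

Definition busemann (c : R -> X) (x : X) : R :=
  lim ((t - mdist x (c t)) @[t --> +oo]).

End metric_space.
Arguments is_separable {R} X.
Arguments is_geodesic_space {R} X.

Section measures.
Context {R : realType} {X : completePMetricType R}.

Definition msupport (mu : set (borel X) -> \bar R) : set X :=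
  [set x | forall U : set X, open U -> U x -> (0 < mu U)%E].

Definition is_radon (m : {measure set (borel X) -> \bar R}) :=
  (forall K : set X, compact K -> (m K < +oo)%E) /\
  (forall A : set (borel X), measurable A ->
     m A = ereal_sup [set m K | K in [set K : set X | compact K /\ K `<=` A]]).

(* Completeness is part of the type of X. *)
Record is_metric_measure_space (m : {measure set (borel X) -> \bar R}) : Prop :=
  MetricMeasureSpace {
    mms_separable : is_separable X;
    mms_geodesic : is_geodesic_space X;
    mms_radon : is_radon m;
    mms_bounded : forall A : set (borel X),
      measurable A -> metric_bounded A -> (m A < +oo)%E;
    mms_support : msupport m = [set: X] }.

End measures.

Definition unit_itv (R : realType) : Type := set_type `[0 : R, 1]%classic.
HB.instance Definition _ (R : realType) := 
  Topological.copy (unit_itv R) (set_type `[0 : R, 1]%classic).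

Section unit_itv_proj.
Context {R : realType}.

Let clamp_in (t : R) : Num.max 0 (Num.min 1 t) \in `[0 : R, 1]%classic.
Proof.
by apply/mem_set; rewrite /= in_itv /= le_max lexx /= ge_max ler01 ge_min lexx.
Qed.

(* The retraction of R onto [0,1]. *)
Definition unit_proj (t : R) : unit_itv R :=
  exist (fun x : R => x \in `[0 : R, 1]%classic) _ (clamp_in t).

End unit_itv_proj.

Section curves.
Context {R : realType}.

(* C([0,1], X) with the topology of uniform convergence. *)
Definition curve (X : completePMetricType R) : Type :=
  initial_topology
    (id : continuousType (unit_itv R) X -> {uniform unit_itv R -> X}).

HB.instance Definition _ X := Topological.copy (curve X)
  (initial_topology
    (id : continuousType (unit_itv R) X -> {uniform unit_itv R -> X})).
HB.instance Definition _ X := isPointed.Build (curve X)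
  (cst point : continuousType (unit_itv R) X).

Context {X : completePMetricType R}.
Implicit Types eta : curve X.

(* [ev t eta] is eta_t for t in [0,1]; for t outside of [0,1] it is the value
   at the nearest endpoint. *)
Definition ev (t : R) (eta : curve X) : X :=
  (eta : continuousType (unit_itv R) X) (unit_proj t).

Definition abs_continuous eta := exists2 g : R -> R,
  lebesgue_measure.-integrable `[0, 1] (EFin \o g) &
  forall s t, 0 <= s -> s <= t -> t <= 1 ->
    ((mdist (ev s eta) (ev t eta))%:E <=
       \int[lebesgue_measure]_(r in `[s, t]) (g r)%:E)%E.

(* For absolutely continuous eta the limit exists for a.e. t in [0,1]. *)
Definition metric_speed eta (t : R) : R :=
  lim ((mdist (ev (t + h) eta) (ev t eta) / `|h|) @[h --> 0^']).

Definition energy eta : \bar R :=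
  if `[< abs_continuous eta >]
  then (\int[lebesgue_measure]_(t in `[0%R, 1%R]) (metric_speed eta t ^+ 2)%:E)%E
  else +oo%E.

End curves.

Section sobolev.
Context {R : realType} {X : completePMetricType R}.
Variable m : {measure set (borel X) -> \bar R}.
Implicit Types (f G : borel X -> R).

Definition is_test_plan (pi : probability (borel (curve X)) R) :=
  (exists2 C : R, 0 < C & forall t, 0 <= t <= 1 ->
     forall A : set (borel X), measurable A ->
       (pushforward pi (ev t : borel (curve X) -> borel X) A <= C%:E * m A)%E)
  /\ (\int[pi]_eta energy eta < +oo)%E.

Definition weak_upper_gradient f G := [/\
  forall x, 0 <= G x,
  G \in Lfun m 2%:E &
  forall pi, is_test_plan pi ->
    (\int[pi]_eta `|f (ev 1 eta) - f (ev 0 eta)|%:E <=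
     \int[pi]_eta \int[lebesgue_measure]_(t in `[0%R, 1%R])
       (G (ev t eta) * metric_speed eta t)%:E)%E].

Definition S2 : set (borel X -> R) :=
  [set f | measurable_fun setT f /\ exists G, weak_upper_gradient f G].

Definition is_minimal_wug f G :=
  weak_upper_gradient f G /\
  forall G', weak_upper_gradient f G' -> {ae m, forall x, G x <= G' x}.

(* |Df|, as a representative of its m-a.e. class. *)
Definition minimal_wug f : borel X -> R := xget (cst 0) (is_minimal_wug f).

Definition W12 : set (borel X -> R) :=
  [set f | f \in Lfun m 2%:E] `&` S2.

Definition L2norm f : R := fine ('N[m]_2%:E [EFin \o f])%E.

Definition W12norm f : R :=
  Num.sqrt (L2norm f ^+ 2 + L2norm (minimal_wug f) ^+ 2).

(* W^{1,2}(X) is a Hilbert space: its norm comes from an inner product and is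
   complete.  Elements are handled through representatives; definiteness modulo
   m-a.e. equality is contained in the relation with the norm. *)
Definition infinitesimally_hilbertian :=
  (exists ip : (borel X -> R) -> (borel X -> R) -> R, [/\
     (forall f g, W12 f -> W12 g -> ip f g = ip g f),
     (forall f g h, W12 f -> W12 g -> W12 h -> ip (f + g) h = ip f h + ip g h),
     (forall (a : R) f g, W12 f -> W12 g -> ip (a \*o f) g = a * ip f g) &
     (forall f, W12 f -> W12norm f ^+ 2 = ip f f)]) /\
  (forall u : nat -> (borel X -> R), (forall n, W12 (u n)) ->
     (forall e, 0 < e -> exists n0, forall i j, (n0 <= i)%N -> (n0 <= j)%N ->
        W12norm (u i - u j) < e) ->
     exists2 f, W12 f & W12norm (u n - f) @[n --> \oo] --> 0).

End sobolev.

Section wasserstein.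
Context {R : realType} {X : completePMetricType R}.
Implicit Types mu nu : probability (borel X) R.

Definition P2 mu :=
  exists x0 : X, (\int[mu]_x (mdist (x : X) x0 ^+ 2)%:E < +oo)%E.

(* For separable X the product sigma-algebra is the Borel one of X * X. *)
Definition coupling mu nu : set (probability (borel X * borel X)%type R) :=
  [set pi | forall A : set (borel X), measurable A ->
     pushforward pi fst A = mu A /\ pushforward pi snd A = nu A].

Definition cost (pi : probability (borel X * borel X)%type R) : \bar R :=
  (\int[pi]_xy (mdist (xy.1 : X) (xy.2 : X) ^+ 2)%:E)%E.

Definition optimal_coupling mu nu pi :=
  coupling mu nu pi /\ forall pi', coupling mu nu pi' -> (cost pi <= cost pi')%E.

Definition W2 mu nu : \bar R :=
  ((ereal_inf [set cost pi | pi in coupling mu nu]) `^ 2^-1)%E.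

(* Measures are compared on measurable sets only: the value of a library measure
   on a nonmeasurable set is unspecified. *)
Definition W2_geodesic mu nu (mut : R -> probability (borel X) R) := [/\
  forall t, 0 <= t <= 1 -> P2 (mut t),
  forall A : set (borel X), measurable A -> mut 0 A = mu A,
  forall A : set (borel X), measurable A -> mut 1 A = nu A &
  forall s t, 0 <= s <= 1 -> 0 <= t <= 1 ->
    W2 (mut s) (mut t) = (`|s - t|%:E * W2 mu nu)%E].

End wasserstein.

Section curvature_dimension.
Context {R : realType} {X : completePMetricType R}.
Variable m : {measure set (borel X) -> \bar R}.
Implicit Types (mu : probability (borel X) R) (rho : borel X -> R).

Definition is_density mu rho := [/\
  measurable_fun setT rho, forall x, 0 <= rho x &
  forall A, measurable A -> mu A = (\int[m]_(x in A) (rho x)%:E)%E].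

(* mu = rho m + mus with mus singular with respect to m *)
Definition lebesgue_decomposition mu rho
    (mus : {measure set (borel X) -> \bar R}) := [/\
  measurable_fun setT rho, forall x, 0 <= rho x,
  exists2 S : set (borel X), measurable S & m S = 0%E /\ mus (~` S) = 0%E &
  forall A, measurable A ->
    mu A = (\int[m]_(x in A) (rho x)%:E + mus A)%E].

Definition ac_density mu : borel X -> R :=
  xget (cst 0) [set rho | exists mus, lebesgue_decomposition mu rho mus].

Definition renyi (n : R) mu : \bar R :=
  let rho := ac_density mu in
  if 1 < n then (- \int[m]_x (rho x `^ (1 - n^-1))%R%:E)%E
  else (- m [set x | (0 < rho x)%R])%E.

(* The library's value of 0 to a negative power is 0; this does not matter, as
   {rho0 = 0} and {rho1 = 0} are negligible for the marginals of pi. *)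
Definition CD0 (N : R) :=
  forall (mu0 mu1 : probability (borel X) R) (rho0 rho1 : borel X -> R),
    P2 mu0 -> P2 mu1 ->
    is_density mu0 rho0 -> is_density mu1 rho1 ->
    metric_bounded (msupport mu0) -> metric_bounded (msupport mu1) ->
    exists pi mut, [/\ optimal_coupling mu0 mu1 pi, W2_geodesic mu0 mu1 mut &
      forall t n, 0 <= t <= 1 -> N <= n ->
        (renyi n (mut t) <=
         - \int[pi]_xy ((1 - t) * rho0 xy.1 `^ (- n^-1)
                        + t * rho1 xy.2 `^ (- n^-1))%R%:E)%E].

Record is_RCD0 (N : R) : Prop := RCD0 {
  rcd_mms : is_metric_measure_space m;
  rcd_hilbert : infinitesimally_hilbertian m;
  rcd_cd : CD0 N }.

End curvature_dimension.

(* Main.v *)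
Require Import Defs.
From mathcomp Require Import all_boot all_order all_algebra.
From mathcomp Require Import all_classical all_reals all_analysis.
From mathcomp Require Import measurable_realfun zify ring lra.
Set Implicit Arguments.
Unset Strict Implicit.
Unset Printing Implicit Defensive.
Import Order.TTheory GRing.Theory Num.Theory.
Import numFieldNormedType.Exports.
Local Open Scope classical_set_scope.
Local Open Scope ring_scope.

(** The constant is [C0 = 2]: for every [e > 0] there is a [C] such that all
    points satisfy [(1 - e) d(p, x) <= |b x| + C] ([mdist_le_busemann]), so the
    level set of height [r] lies in a ball around [p] of radius about
    [r / (1 - e)].

    The estimate holds because the volume has no room away from the flow of
    [b].  Moving a set towards [gamma T], with [T] very large, raises [b] at
    unit speed and, by the curvature-dimension condition, loses no volume in
    the limit.  The shifted copies of a bounded piece of the slab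
    [a < b <= a + 1] are disjoint, and those of the first [J] steps lie in a
    ball of radius [J] plus a constant; linear volume growth thus bounds the
    volumes of all unit slabs, and [al] denotes their supremum.  Choose a
    bounded piece of a unit slab with volume above [al - de].  Its copies fill
    each later slab of height [J] up to volume [al + J de], and they remain
    within distance [b] plus a constant of [p].  If [D = d(p, x)] exceeded
    [|b x|] by a fixed proportion of [D], one could walk uphill from [x] by at
    most [|b x|] plus a small multiple of [D], to a positive height, and would
    still be too far from [p] to meet the copies: a ball of radius proportional
    to [D] around the point reached would lie in the unfilled part, so its
    volume would be at most [al + J de] with [J <= D].  But a ball
    comparison of Bishop-Gromov type, together with the linear lower bound for
    the volumes of the balls around [p], gives it a volume at least
    proportional to [D], with a factor independent of [de].

    Both volume estimates are instances of one contraction inequality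
    ([CD0_contraction]): a set which contains all the points that divide, up to
    a fixed error, the segments from [A] to [w] in the ratio [t : 1 - t] has
    volume at least [(1 - t)^k m A].  It is obtained from a Wasserstein
    geodesic that ends in the uniform measure on [ball w r], as [r] tends to
    [0].  When the target is almost a point, an almost optimal coupling of the
    initial and the intermediate measure is enough to locate the latter, so no
    gluing of couplings is needed: the mass off the approximate division points
    is [O(r)], even weighted by the squared distance to [w].  The weight
    controls the Renyi entropy of that stray mass, because the reciprocal
    weight is integrable under linear volume growth. *)

(** * Borel structure of a metric space *)

Section borel_metric.
Context {R : realType} {X : completePMetricType R}.
Implicit Types (x y : X).

Lemma lt_measurable_fun d (T : measurableType d) (f : T -> R) :
  (forall r, measurable [set x | f x < r]) -> measurable_fun setT f.
Proof.
move=> mf; apply: (measurability _ (RGenInftyO.measurableE R)).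
move=> _ [_ [a ->] <-]; rewrite setTI.
rewrite (_ : _ @^-1` _ = [set x | f x < a]); first exact: mf.
by apply/seteqP; split => t /=; rewrite in_itv.
Qed.

Lemma open_borel (U : set X) : open U -> measurable (U : set (borel X)).
Proof. exact: sub_sigma_algebra. Qed.

Lemma open_mball x r : open (ball x r).
Proof.
rewrite openE => y /= xy; rewrite ballEmdist /= in xy.
apply/nbhs_ballP; exists (r - mdist x y) => /=; first by rewrite subr_gt0.
move=> z; rewrite !ballEmdist/= ltrBrDl; apply: le_lt_trans.
exact: metric_triangle.
Qed.

Lemma measurable_mball x r : measurable (ball x r : set (borel X)).
Proof. by apply: open_borel; exact: open_mball. Qed.

Lemma lipschitz_lt_open (f : X -> R) (r : R) :
  (forall x y, f x <= f y + mdist x y) -> open [set x | f x < r].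
Proof.
move=> fL; rewrite openE => x /= fx.
apply/nbhs_ballP; exists (r - f x) => /=; first by rewrite subr_gt0.
move=> z; rewrite ballEmdist/= metric_sym => xz.
by have := fL z x; lra.
Qed.

Lemma lipschitz_measurable (f : X -> R) :
  (forall x y, f x <= f y + mdist x y) -> measurable_fun setT (f : borel X -> R).
Proof.
move=> fL; apply: lt_measurable_fun => r.
by apply: open_borel; exact: lipschitz_lt_open.
Qed.

Lemma measurable_mdistr (w : X) :
  measurable_fun setT (fun x : borel X => mdist (x : X) w).
Proof.
by apply: lipschitz_measurable => x y; rewrite addrC; exact: metric_triangle.
Qed.

Lemma measurable_mdistl (w : X) : measurable_fun setT (mdist w : borel X -> R).
Proof.
apply: lipschitz_measurable => x y.
by rewrite (metric_sym x y); exact: metric_triangle.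
Qed.

(** Separability is what makes the distance measurable for the product of the
    two Borel sigma-algebras: [d(x, y) < r] exactly when
    [d(x, q) + d(q, y) < r] for some [q] in a countable dense set. *)
Lemma measurable_mdist : is_separable X ->
  measurable_fun setT
    (fun xy : (borel X * borel X)%type => mdist (xy.1 : X) (xy.2 : X)).
Proof.
move=> [D /pfcard_geP[->|[e]] dD].
  by have [z []] := dD setT (ex_intro _ point Logic.I) openT.
apply: lt_measurable_fun => r.
pose g q (xy : borel X * borel X) := mdist (xy.1 : X) (q : X) + mdist q (xy.2 : X).
rewrite (_ : [set _ | _] = \bigcup_(k in [set: nat]) [set xy | g (e k) xy < r]).
  apply: bigcup_measurable => k _.
  rewrite -[X in measurable X]setTI.
  rewrite (_ : [set xy | _] = g (e k) @^-1` `]-oo, r[%classic); last first.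
    by apply/seteqP; split => t /=; rewrite in_itv.
  apply: measurable_funD => //.
    by apply: (measurableT_comp (measurable_mdistr _)); exact: measurable_fst.
  by apply: (measurableT_comp (measurable_mdistl _)); exact: measurable_snd.
apply/seteqP; split => [[x y]/= xy|[x y]/= [k _] /=]; last first.
  exact/le_lt_trans/metric_triangle.
have [|q []] := dD (ball x ((r - mdist x y) / 2)) _ (open_mball _ _).
  by exists x; rewrite ballEmdist/= mdistxx divr_gt0// subr_gt0.
rewrite ballEmdist /= => xq Dq.
have [k _ ekq] := @surj _ _ _ _ e q Dq.
exists k => //=; rewrite /g /= ekq.
by have := metric_triangle q x y; rewrite (metric_sym q x); lra.
Qed.

End borel_metric.

(** * Measures, densities and couplings *)

Section measure_lemmas.
Context d (T : measurableType d) (R : realType).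
Implicit Types (m mu : {measure set T -> \bar R}).
Local Open Scope ereal_scope.

Lemma exists_uniform_probability m (A : set T) (x0 : T) : measurable A ->
  0 < m A -> m A < +oo ->
  exists mu : probability T R, forall U, measurable U ->
    mu U = m (U `&` A) * ((fine (m A))^-1)%:E.
Proof.
move=> mA A0 Aoo.
exists (mnormalize (mrestr m mA) (\d_x0)%R) => U mU.
have AT : mrestr m mA [set: T] = m A by rewrite /mrestr setTI.
rewrite /= /mnormalize /= AT.
by rewrite gt_eqF//= lt_eqF.
Qed.

Import HBNNSimple.

(** A domination of [rho m] by [mu] on sets passes to nonnegative integrands,
    by simple functions and monotone convergence. *)
Lemma ge0_integral_density_le m mu (rho : T -> R) (h : T -> \bar R) (A : set T) :
  measurable A -> measurable_fun setT rho -> (forall x, (0 <= rho x)%R) ->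
  (forall B, measurable B -> \int[m]_(x in B) (rho x)%:E <= mu B) ->
  measurable_fun A h -> (forall x, A x -> 0 <= h x) ->
  \int[m]_(x in A) (h x * (rho x)%:E) <= \int[mu]_(x in A) h x.
Proof.
move=> mA mrho rho0 rhomu mh h0.
pose g := nnsfun_approx mA mh.
have mrhoE B : measurable_fun B (EFin \o rho).
  by apply: measurable_funTS; exact/measurable_EFinP.
have cvg_g x : A x -> (EFin \o g^~ x) @ \oo --> h x.
  by move=> Ax; exact: cvg_nnsfun_approx.
have -> : \int[m]_(x in A) (h x * (rho x)%:E) =
    limn (fun n => \int[m]_(x in A) ((g n x)%:E * (rho x)%:E)).
  rewrite -monotone_convergence//.
  - apply: eq_integral => x /[!inE] Ax; apply/esym/cvg_lim => //.
    by apply: cvgeZr => //; exact: cvg_g.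
  - move=> n; apply: emeasurable_funM => //.
    by apply/measurable_EFinP; exact: measurable_funTS.
  - by move=> n x _; rewrite mule_ge0 ?lee_fin.
  - move=> x Ax a b ab; rewrite lee_wpmul2r ?lee_fin//.
    exact/lefP/nd_nnsfun_approx.
apply: lime_le.
  apply: ereal_nondecreasing_is_cvgn => a b ab.
  apply: ge0_le_integral => //.
  - by move=> x _; rewrite mule_ge0 ?lee_fin.
  - apply: emeasurable_funM => //.
    by apply/measurable_EFinP; exact: measurable_funTS.
  - apply: emeasurable_funM => //.
    by apply/measurable_EFinP; exact: measurable_funTS.
  - move=> x Ax; rewrite lee_wpmul2r ?lee_fin//.
    exact/lefP/nd_nnsfun_approx.
apply: nearW => n.
have gE x : (g n x)%:E = \sum_(y \in range (g n)) (y * \1_(g n @^-1` [set y]) x)%:E.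
  by rewrite fimfunE -fsumEFin.
have -> : \int[m]_(x in A) ((g n x)%:E * (rho x)%:E) =
    \sum_(y \in range (g n)) (y%:E * \int[m]_(x in A `&` g n @^-1` [set y]) (rho x)%:E).
  under eq_integral => x _.
    rewrite gE ge0_mule_fsuml; last by move=> y; exact: nnfun_muleindic_ge0.
    over.
  rewrite ge0_integral_fsum//; last 2 first.
  - move=> y; apply: emeasurable_funM => //.
    by apply/measurable_EFinP; apply: measurable_funM.
  - move=> y x _; apply: mule_ge0; first exact: nnfun_muleindic_ge0.
    by rewrite lee_fin.
  apply: eq_fsbigr => y; rewrite inE => -[z _ zy].
  under eq_integral do rewrite EFinM -muleA.
  rewrite ge0_integralZl//; last 3 first.
  - apply: emeasurable_funM => //.
    by apply/measurable_EFinP; exact: measurable_funTS.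
  - by move=> x _; rewrite mule_ge0 ?lee_fin.
  - by rewrite -zy lee_fin.
  congr (_ * _); under eq_integral do rewrite muleC.
  rewrite (eq_integral ((EFin \o rho) \_ (g n @^-1` [set y]))); last first.
    by move=> x xE; rewrite epatch_indic.
  by rewrite -integral_mkcondr.
apply: (@le_trans _ _ (\sum_(y \in range (g n)) (y%:E * mu (A `&` g n @^-1` [set y])))).
  apply: lee_fsum => // y [z _ zy].
  by apply: lee_wpmul2l; [rewrite -zy lee_fin|apply: rhomu; exact: measurableI].
have -> : \sum_(y \in range (g n)) (y%:E * mu (A `&` g n @^-1` [set y])) =
   \int[mu]_(x in A) (g n x)%:E.
  under [RHS]eq_integral do rewrite gE.
  rewrite ge0_integral_fsum//; last 2 first.
  - by move=> y; apply/measurable_EFinP; apply: measurable_funM.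
  - by move=> y x _; rewrite nnfun_muleindic_ge0.
  apply: eq_fsbigr => y; rewrite inE => -[z _ zy].
  under eq_integral do rewrite EFinM.
  rewrite ge0_integralZl_EFin//; last 2 first.
  - by apply/measurable_EFinP.
  - by rewrite -zy.
  by rewrite integral_indic// setIC.
apply: ge0_le_integral => //.
- by move=> x _; rewrite lee_fin.
- by apply/measurable_EFinP; exact: measurable_funTS.
- move=> x Ax.
  have /ereal_nondecreasing_cvgn cvg_sup :
      {homo (fun k => (g k x)%:E) : a b / (a <= b)%N >-> a <= b}.
    by move=> a b ab; rewrite lee_fin; exact/lefP/nd_nnsfun_approx.
  rewrite (cvg_unique _ (cvg_g x Ax) cvg_sup)//.
  by apply: ereal_sup_ubound; exists n.
Qed.

End measure_lemmas.

(** The tangent line of the concave function [r `^ (1 - n^-1)] at the point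
    [s `^ (- n)].  Used under the integral sign with a varying [s], it plays
    the role of a weighted Hoelder inequality. *)
Lemma young_powR (R : realType) (n s r : R) : 1 < n -> 0 < s -> 0 <= r ->
  r `^ (1 - n^-1) <= (1 - n^-1) * (s * r) + n^-1 * s `^ (1 - n).
Proof.
move=> n1 s0 r0.
have n0 : 0 < n by rewrite (lt_trans _ n1).
have nV : 0 < 1 - n^-1 by rewrite subr_gt0 invf_lt1.
set q := 1 - n^-1 in nV *.
have -> : r `^ q = (s * r) `^ q * s `^ (- q).
  rewrite powRM//; last exact: ltW.
  rewrite mulrAC -powRD ?subrr ?powRr0 ?mul1r//.
  by rewrite (gt_eqF s0) implybT.
apply: le_trans (@conjugate_powR _ _ _ q^-1 n _ _ _ _ _) _.
- exact: powR_ge0.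
- exact: powR_ge0.
- by rewrite invr_gt0.
- exact: n0.
- by rewrite invrK /q subrK.
rewrite -!powRrM mulfV ?gt_eqF// powRr1; last by rewrite mulr_ge0// ltW.
rewrite invrK.
rewrite [s * r * q]mulrC [_ / n]mulrC lerD2l ler_pM2l ?invr_gt0//.
by rewrite mulNr /q mulrBl mul1r mulVf ?gt_eqF// opprB.
Qed.

Section couplings.
Context {R : realType} {X : completePMetricType R}.
Implicit Types mu nu : probability (borel X) R.
Local Open Scope ereal_scope.

Lemma coupling_integral_fst mu nu pi (f : borel X -> \bar R) :
  coupling mu nu pi -> measurable_fun setT f -> (forall x, 0 <= f x) ->
  \int[pi]_xy f xy.1 = \int[mu]_x f x.
Proof.
move=> cpl mf f0.
rewrite -(@ge0_integral_pushforward _ _ _ _ _ fst measurable_fst pi setT f)//.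
by apply: eq_measure_integral => A mA _; exact: (cpl A mA).1.
Qed.

Lemma coupling_integral_snd mu nu pi (f : borel X -> \bar R) :
  coupling mu nu pi -> measurable_fun setT f -> (forall x, 0 <= f x) ->
  \int[pi]_xy f xy.2 = \int[nu]_x f x.
Proof.
move=> cpl mf f0.
rewrite -(@ge0_integral_pushforward _ _ _ _ _ snd measurable_snd pi setT f)//.
by apply: eq_measure_integral => A mA _; exact: (cpl A mA).2.
Qed.

(** The squared distance is the infimum of the costs itself, so it avoids the
    square root, and inequalities on couplings pass to it directly. *)
Definition W2sq mu nu := ereal_inf [set cost pi | pi in coupling mu nu].

Lemma cost_ge0 (pi : probability (borel X * borel X)%type R) : 0 <= cost pi.
Proof. by apply: integral_ge0 => xy _; rewrite lee_fin sqr_ge0. Qed.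

Lemma W2sq_ge0 mu nu : 0 <= W2sq mu nu.
Proof. by apply: le_ereal_inf_tmp => _ [pi _ <-]; exact: cost_ge0. Qed.

Lemma W2_sqr mu nu : W2 mu nu ^+ 2 = W2sq mu nu.
Proof. by rewrite /W2 poweR12_sqrt ?sqr_sqrte// W2sq_ge0. Qed.

Lemma W2_geodesic_W2sq mu nu mut s t : W2_geodesic mu nu mut ->
  (0 <= s <= 1)%R -> (0 <= t <= 1)%R ->
  W2sq (mut s) (mut t) = ((s - t) ^+ 2)%:E * W2sq mu nu.
Proof.
move=> [_ _ _ geo] s01 t01; rewrite -!W2_sqr geo//.
by rewrite !expe2 muleACA -EFinM -expr2 real_normK// num_real.
Qed.

Lemma W2_geodesic_W2sq0 mu nu mut t : W2_geodesic mu nu mut ->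
  (0 <= t <= 1)%R -> W2sq mu (mut t) = (t ^+ 2)%:E * W2sq mu nu.
Proof.
move=> geo t01; have [_ mu0 _ _] := geo.
have -> : W2sq mu (mut t) = W2sq (mut 0%R) (mut t).
  congr (ereal_inf (_ @` _)); apply/funext => pi; apply/propext.
  by split=> cpl A mA; have := cpl A mA; rewrite mu0.
by rewrite (W2_geodesic_W2sq geo)// ?lexx ?ler01// sub0r sqrrN.
Qed.

Lemma W2_geodesic_W2sq1 mu nu mut t : W2_geodesic mu nu mut ->
  (0 <= t <= 1)%R -> W2sq (mut t) nu = ((1 - t) ^+ 2)%:E * W2sq mu nu.
Proof.
move=> geo t01; have [_ _ mu1 _] := geo.
have -> : W2sq (mut t) nu = W2sq (mut t) (mut 1%R).
  congr (ereal_inf (_ @` _)); apply/funext => pi; apply/propext.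
  by split=> cpl A mA; have := cpl A mA; rewrite mu1.
by rewrite (W2_geodesic_W2sq geo)// ?lexx ?ler01// -sqrrN opprB.
Qed.

End couplings.

(** * Excess of a triangle over a geodesic *)

Section excess.
Context {R : realType}.
Implicit Types (a b c t D e : R).

(** The excess of [a^2 / t + b^2 / (1 - t)] over [(a + b)^2] is
    [((1 - t) a - t b)^2 / (t (1 - t))].  A small excess over [c^2] therefore
    makes [a + b] close to [c] and the ratio of [a] to [b] close to
    [t : 1 - t]. *)
Lemma midpoint_excess a b c t e : 0 < t < 1 -> 0 < e -> 0 <= a -> 0 <= b ->
  0 <= c <= a + b -> ~ (a <= t * c + e /\ b <= (1 - t) * c + e) ->
  c ^+ 2 + (e / 2) ^+ 2 <= a ^+ 2 / t + b ^+ 2 / (1 - t).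
Proof.
move=> /andP[t0 t1] e0 a0 b0 /andP[c0 cab] nmid.
have t1' : 0 < 1 - t by rewrite subr_gt0.
rewrite leNgt; apply/negP => lt_excess; apply: nmid.
pose h := (1 - t) * a - t * b.
have E : a ^+ 2 / t + b ^+ 2 / (1 - t) = (a + b) ^+ 2 + h ^+ 2 / (t * (1 - t)).
  by rewrite /h; field; rewrite !gt_eqF.
have tt0 : 0 < t * (1 - t) by rewrite mulr_gt0.
have h0 : 0 <= h ^+ 2 / (t * (1 - t)) by rewrite divr_ge0 ?sqr_ge0// ltW.
rewrite E in lt_excess.
have c2 : c ^+ 2 <= (a + b) ^+ 2 by rewrite ler_sqr ?nnegrE// addr_ge0.
have e20 : 0 <= e / 2 by rewrite divr_ge0// ltW.
have ab : a + b < c + e / 2.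
  rewrite -ltr_sqr ?nnegrE ?addr_ge0//.
  have : 0 <= c * (e / 2) by rewrite mulr_ge0.
  by rewrite [ltRHS]sqrrD; lra.
have : h ^+ 2 < (e / 2) ^+ 2.
  have : h ^+ 2 / (t * (1 - t)) < (e / 2) ^+ 2 by nra.
  rewrite ltr_pdivrMr// => /lt_le_trans; apply.
  by rewrite ler_piMr ?sqr_ge0//; nra.
rewrite -[h ^+ 2]real_normK ?num_real// ltr_sqr ?nnegrE// ltr_norml => /andP[h1 h2].
rewrite /h in h1 h2.
have tab : t * (a + b) <= t * (c + e / 2) by rewrite ler_wpM2l// ltW.
have tab' : (1 - t) * (a + b) <= (1 - t) * (c + e / 2) by rewrite ler_wpM2l// ltW.
have te : t * e <= e by rewrite ler_piMl// ltW.
have te' : 0 <= t * e by rewrite mulr_ge0// ltW.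
by split; nra.
Qed.

(** The excess away from the division points is bounded below by a constant
    and grows quadratically in [b]; the coefficient comes from averaging these
    two lower bounds. *)
Lemma quadratic_excess a b c t e D : 0 < t < 1 -> 0 < e -> 0 <= a -> 0 <= b ->
  0 <= c <= a + b -> c <= D -> ~ (a <= t * c + e /\ b <= (1 - t) * c + e) ->
  c ^+ 2 + (e / 2) ^+ 2 / (1 + (e / 2) ^+ 2 + D ^+ 2) * (1 + b ^+ 2) <=
    a ^+ 2 / t + b ^+ 2 / (1 - t).
Proof.
move=> t01 e0 a0 b0 c0 cD /(midpoint_excess t01 e0 a0 b0 c0).
move: t01 c0 => /andP[t0 t1] /andP[c0 _].
have k0 : 0 < (e / 2) ^+ 2 by rewrite exprn_gt0// divr_gt0.
have bt : b ^+ 2 <= b ^+ 2 / (1 - t).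
  by rewrite ler_pdivlMr ?subr_gt0// ler_piMr ?sqr_ge0//; lra.
have at0 : 0 <= a ^+ 2 / t by rewrite divr_ge0 ?sqr_ge0// ltW.
have cD2 : c ^+ 2 <= D ^+ 2 by rewrite ler_sqr ?nnegrE// (le_trans c0).
move: (a ^+ 2 / t) (b ^+ 2 / (1 - t)) at0 bt => u v u0 bv.
move: ((e / 2) ^+ 2) k0 (c ^+ 2) (sqr_ge0 c) (b ^+ 2) (sqr_ge0 b) bv (D ^+ 2) cD2.
move=> k k0 c2 c20 b2 b20 bv D2 cD2 kuv.
have K0 : 0 < 1 + k + D2 by lra.
rewrite -lerBrDl mulrAC ler_pdivrMr//.
by nra.
Qed.

End excess.

(** * Transport towards a small ball *)

Section energy.
Context {R : realType} {X : completePMetricType R}.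
Implicit Types (mu nu : probability (borel X) R).
Hypothesis sepX : is_separable X.
Local Open Scope ereal_scope.

Definition sqdist (w : X) : borel X -> \bar R := fun x => (mdist (x : X) w ^+ 2)%:E.

Lemma measurable_sqdist w : measurable_fun setT (sqdist w).
Proof.
by apply/measurable_EFinP; apply: measurable_funX; exact: measurable_mdistr.
Qed.

Lemma sqdist_ge0 w x : 0 <= sqdist w x.
Proof. by rewrite lee_fin sqr_ge0. Qed.

Definition cost_fun : (borel X * borel X)%type -> \bar R :=
  fun xy => (mdist (xy.1 : X) (xy.2 : X) ^+ 2)%:E.

Lemma measurable_cost_fun : measurable_fun setT cost_fun.
Proof.
by apply/measurable_EFinP; apply: measurable_funX; exact: measurable_mdist.
Qed.

Lemma coupling_ae_snd mu nu pi (B : set (borel X)) : coupling mu nu pi ->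
  measurable B -> nu (~` B) = 0 -> {ae pi, forall xy, B xy.2}.
Proof.
move=> cpl mB nuB; exists (snd @^-1` (~` B)); split.
- rewrite -[X in measurable X]setTI; apply: measurable_snd => //.
  exact: measurableC.
- by rewrite -nuB -(cpl _ (measurableC mB)).2.
- by move=> xy /=.
Qed.

Lemma coupling_ae_fst mu nu pi (B : set (borel X)) : coupling mu nu pi ->
  measurable B -> mu (~` B) = 0 -> {ae pi, forall xy, B xy.1}.
Proof.
move=> cpl mB muB; exists (fst @^-1` (~` B)); split.
- rewrite -[X in measurable X]setTI; apply: measurable_fst => //.
  exact: measurableC.
- by rewrite -muB -(cpl _ (measurableC mB)).1.
- by move=> xy /=.
Qed.

(** Young's inequality [2 a r <= r a^2 + r] makes the error proportional to
    [r]. *)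
Lemma sqr_perturb (a b r : R) : (0 <= a)%R -> (0 <= b)%R -> (0 < r)%R ->
  (b <= a + r -> b ^+ 2 <= (1 + r) * (a ^+ 2 + r))%R.
Proof.
move=> a0 b0 r0 ab.
have /le_trans -> // : (b ^+ 2 <= (a + r) ^+ 2)%R.
  by rewrite ler_sqr ?nnegrE// addr_ge0// ltW.
have : (0 <= r * (a - 1) ^+ 2)%R by rewrite mulr_ge0 ?sqr_ge0// ltW.
by rewrite sqrrB sqrrD; lra.
Qed.

(** When [nu] lives on [ball w r], every coupling with [nu] has almost the cost
    of the transport to the point [w], which does not depend on the
    coupling. *)
Section ball_target.
Variables (mu nu : probability (borel X) R) (w : X) (r : R).
Hypotheses (r0 : (0 < r)%R) (nuw : nu (~` (ball w r)) = 0).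

Lemma cost_le_of_coupling pi : coupling mu nu pi ->
  cost pi <= (1 + r)%:E * (\int[mu]_x sqdist w x + r%:E).
Proof.
move=> cpl; rewrite -(coupling_integral_fst cpl (measurable_sqdist w)); last first.
  exact: sqdist_ge0.
have mf : measurable_fun setT (fun xy : borel X * borel X => sqdist w xy.1).
  by apply: measurableT_comp; [exact: measurable_sqdist|exact: measurable_fst].
have -> : r%:E = \int[pi]_xy (cst r%:E xy).
  by rewrite integral_cst// [X in _ * X]probability_setT mule1.
rewrite -ge0_integralD//; last 2 first.
  by move=> x _; rewrite sqdist_ge0.
  by move=> x _; rewrite lee_fin ltW.
rewrite -ge0_integralZl_EFin//; last 3 first.
  by move=> x _; rewrite adde_ge0// ?sqdist_ge0// lee_fin ltW.
  by apply: emeasurable_funD.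
  by rewrite addr_ge0// ltW.
apply: ae_ge0_le_integral => //.
- by move=> xy _; rewrite lee_fin sqr_ge0.
- exact: measurable_cost_fun.
- move=> x _; apply: mule_ge0; first by rewrite lee_fin addr_ge0// ltW.
  by rewrite adde_ge0// ?sqdist_ge0// lee_fin ltW.
- by apply: measurable_funeM; exact: emeasurable_funD.
have := coupling_ae_snd cpl (measurable_mball w r) nuw.
apply: filterS => -[x y] /= wy _; rewrite /sqdist /= -EFinD -EFinM lee_fin.
rewrite ballEmdist/= in wy.
apply: sqr_perturb; rewrite ?mdist_ge0//.
by have := metric_triangle x w y; lra.
Qed.

Lemma second_moment_le_of_coupling pi : coupling mu nu pi ->
  \int[mu]_x sqdist w x <= (1 + r)%:E * (cost pi + r%:E).
Proof.
move=> cpl; rewrite -(coupling_integral_fst cpl (measurable_sqdist w)); last first.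
  exact: sqdist_ge0.
have mf : measurable_fun setT (fun xy : borel X * borel X => sqdist w xy.1).
  by apply: measurableT_comp; [exact: measurable_sqdist|exact: measurable_fst].
have mc := measurable_cost_fun.
have c0 xy : 0 <= cost_fun xy by rewrite lee_fin sqr_ge0.
have -> : r%:E = \int[pi]_xy (cst r%:E xy).
  by rewrite integral_cst// [X in _ * X]probability_setT mule1.
rewrite -[cost pi]/(\int[pi]_xy cost_fun xy).
rewrite -ge0_integralD//; last first.
  by move=> x _; rewrite lee_fin ltW.
rewrite -ge0_integralZl_EFin//; last 3 first.
  by move=> x _; rewrite adde_ge0// lee_fin ltW.
  exact: emeasurable_funD.
  by rewrite addr_ge0// ltW.
apply: ae_ge0_le_integral => //.
- by move=> xy _; rewrite sqdist_ge0.
- move=> x _; apply: mule_ge0; first by rewrite lee_fin addr_ge0// ltW.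
  by rewrite adde_ge0// lee_fin ltW.
- by apply: measurable_funeM; exact: emeasurable_funD.
have := coupling_ae_snd cpl (measurable_mball w r) nuw.
apply: filterS => -[x y] /= wy _; rewrite /sqdist /= -EFinD -EFinM lee_fin.
rewrite ballEmdist/= in wy.
apply: sqr_perturb; rewrite ?mdist_ge0//.
by have := metric_triangle x y w; rewrite (metric_sym y w); lra.
Qed.

Lemma second_moment_le_W2sq :
  \int[mu]_x sqdist w x <= (1 + r)%:E * (W2sq mu nu + r%:E).
Proof.
have r1 : (0 < 1 + r)%R by rewrite addr_gt0.
rewrite -lee_pdivrMl// -leeBlDr//.
apply: le_ereal_inf_tmp => _ [pi cpl <-].
rewrite leeBlDr// lee_pdivrMl//.
exact: second_moment_le_of_coupling.
Qed.

End ball_target.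
End energy.

Section transport_excess.
Context {R : realType} {X : completePMetricType R}.
Hypothesis sepX : is_separable X.
Local Open Scope ereal_scope.

Definition sqweight (w : X) : borel X -> \bar R :=
  fun z => (1 + mdist (z : X) w ^+ 2)%:E.

Lemma measurable_sqweight w : measurable_fun setT (sqweight w).
Proof.
apply/measurable_EFinP; apply: measurable_funD => //.
by apply: measurable_funX; exact: measurable_mdistr.
Qed.

Lemma sqweight_ge0 w z : 0 <= sqweight w z.
Proof. by rewrite lee_fin addr_ge0// sqr_ge0. Qed.

(** The excess [d(x, z)^2 / t + d(z, w)^2 / (1 - t) - d(x, w)^2] has integral
    [O(r)] under an almost optimal coupling of [mu0] and [mut t]: the first
    term is controlled by the geodesic from [mu0] to [mut t], and the other two
    depend on one marginal each, where [w] may replace the points of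
    [ball w r].  Where the excess is at least [th (1 + d(z, w)^2)], this bounds
    the mass of [mut t], with its second moment. *)
Lemma transport_excess_le (mu0 mu1 : probability (borel X) R) mut pi
    (A Z : set (borel X)) (w : X) (t r D th : R) :
  W2_geodesic mu0 mu1 mut -> coupling mu0 mu1 pi ->
  measurable A -> mu0 (~` A) = 0 -> measurable Z ->
  mu1 (~` (ball w r)) = 0 -> (0 < t < 1)%R -> (0 < r <= 1)%R -> (0 <= th)%R ->
  (forall x, A x -> mdist x w <= D)%R ->
  (forall x z, A x -> Z z -> mdist (x : X) w ^+ 2 + th * (1 + mdist (z : X) w ^+ 2)
    <= mdist (x : X) z ^+ 2 / t + mdist (z : X) w ^+ 2 / (1 - t))%R ->
  th%:E * \int[mut t]_(z in Z) sqweight w z <=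
    (r * (3 * D ^+ 2 + 5 + 2 / (1 - t)))%:E.
Proof.
move=> geo cpl mA muA mZ muw /andP[t0 t1] /andP[r0 r1] th0 AD AZ.
have t01 : (0 <= t <= 1)%R by rewrite !ltW.
have t1' : (0 < 1 - t)%R by rewrite subr_gt0.
pose E := \int[mu0]_x sqdist w x.
have ED : E <= (D ^+ 2)%:E.
  have -> : (D ^+ 2)%:E = \int[mu0]_x (cst (D ^+ 2)%:E x).
    by rewrite integral_cst// [X in _ * X]probability_setT mule1.
  apply: ae_ge0_le_integral => //.
  - by move=> x _; exact: sqdist_ge0.
  - exact: measurable_sqdist.
  - by move=> x _; rewrite lee_fin sqr_ge0.
  exists (~` A); split => //; first exact: measurableC.
  move=> x /= nx Ax; apply: nx => _; rewrite /sqdist lee_fin.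
  by rewrite ler_sqr ?nnegrE ?mdist_ge0 ?AD// (le_trans (mdist_ge0 _ _) (AD _ Ax)).
have E0 : 0 <= E by apply: integral_ge0 => x _; exact: sqdist_ge0.
have Efin : E \is a fin_num.
  by rewrite ge0_fin_numE// (le_lt_trans ED)// ltry.
have I_le : W2sq mu0 mu1 <= (1 + r)%:E * (E + r%:E).
  apply: (@le_trans _ _ (cost pi)); last exact: (cost_le_of_coupling sepX r0 muw cpl).
  by apply: ereal_inf_lbound; exists pi.
have Ifin : W2sq mu0 mu1 \is a fin_num.
  rewrite ge0_fin_numE ?W2sq_ge0// (le_lt_trans I_le)//.
  by rewrite -(fineK Efin) -EFinD -EFinM ltry.
have F_le : \int[mut t]_z sqdist w z <=
    (1 + r)%:E * (((1 - t) ^+ 2)%:E * W2sq mu0 mu1 + r%:E).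
  rewrite -(W2_geodesic_W2sq1 geo t01).
  exact: (second_moment_le_W2sq sepX _ r0 muw).
have [tau tau_cpl tau_lt] : exists2 tau, coupling mu0 (mut t) tau &
    cost tau < (t ^+ 2)%:E * W2sq mu0 mu1 + (t * r)%:E.
  rewrite -(W2_geodesic_W2sq0 geo t01).
  have := @lb_ereal_inf_adherent _ [set cost pi | pi in coupling mu0 (mut t)] (t * r)%R.
  rewrite -/(W2sq mu0 (mut t)) mulr_gt0// (W2_geodesic_W2sq0 geo t01) fin_numM//.
  by move=> /(_ isT isT)[_ [tau tau_cpl <-] tau_lt]; exists tau.
pose g : borel X -> \bar R := fun z => th%:E * (sqweight w \_ Z) z.
have g0 z : 0 <= g z.
  by rewrite mule_ge0 ?lee_fin// erestrict_ge0// => x _; exact: sqweight_ge0.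
have mg : measurable_fun setT g.
  apply: measurable_funeM; apply/(measurable_restrictT _ mZ).
  by apply: measurable_funTS; exact: measurable_sqweight.
have mf1 : measurable_fun setT (fun xy : borel X * borel X => sqdist w xy.1).
  by apply: measurableT_comp; [exact: measurable_sqdist|exact: measurable_fst].
have mf2 : measurable_fun setT (fun xy : borel X * borel X => sqdist w xy.2).
  by apply: measurableT_comp; [exact: measurable_sqdist|exact: measurable_snd].
have mg2 : measurable_fun setT (fun xy : borel X * borel X => g xy.2).
  by apply: measurableT_comp; [exact: mg|exact: measurable_snd].
have mc := measurable_cost_fun sepX.
have c0 (xy : borel X * borel X) : 0 <= cost_fun xy by rewrite lee_fin sqr_ge0.
have lower : E + th%:E * \int[mut t]_(z in Z) sqweight w z =
    \int[tau]_xy (sqdist w xy.1 + g xy.2).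
  rewrite ge0_integralD//; last by move=> xy _; exact: sqdist_ge0.
  rewrite (coupling_integral_fst tau_cpl (measurable_sqdist w)); last exact: sqdist_ge0.
  rewrite (coupling_integral_snd tau_cpl mg)//; congr (_ + _).
  rewrite /g ge0_integralZl_EFin//; first by rewrite [in LHS]integral_mkcond.
  - by move=> z _; rewrite erestrict_ge0// => x _; exact: sqweight_ge0.
  - apply/(measurable_restrictT _ mZ).
    by apply: measurable_funTS; exact: measurable_sqweight.
have upper : \int[tau]_xy (t^-1%:E * cost_fun xy + (1 - t)^-1%:E * sqdist w xy.2) =
    t^-1%:E * cost tau + (1 - t)^-1%:E * \int[mut t]_z sqdist w z.
  rewrite ge0_integralD//; last 4 first.
  - by move=> xy _; rewrite mule_ge0// lee_fin invr_ge0 ltW.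
  - exact: measurable_funeM.
  - by move=> xy _; rewrite mule_ge0 ?sqdist_ge0// lee_fin invr_ge0 ltW.
  - exact: measurable_funeM.
  rewrite !ge0_integralZl_EFin//; last 3 first.
  - by move=> xy _; exact: sqdist_ge0.
  - by rewrite invr_ge0 ltW.
  - by rewrite invr_ge0 ltW.
  by rewrite (coupling_integral_snd tau_cpl (measurable_sqdist w))//; exact: sqdist_ge0.
have : E + th%:E * \int[mut t]_(z in Z) sqweight w z <=
    t^-1%:E * cost tau + (1 - t)^-1%:E * \int[mut t]_z sqdist w z.
  rewrite lower -upper; apply: ae_ge0_le_integral => //.
  - by move=> xy _; rewrite adde_ge0// sqdist_ge0.
  - exact: emeasurable_funD.
  - move=> xy _; rewrite adde_ge0// mule_ge0 ?sqdist_ge0// lee_fin invr_ge0 ltW//.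
  - by apply: emeasurable_funD; exact: measurable_funeM.
  apply: filterS (coupling_ae_fst tau_cpl mA muA) => -[x z] /= Ax _.
  rewrite /g patchE; case: ifPn => [|_].
    rewrite inE => Zz; rewrite /sqdist /sqweight /cost_fun /= -!EFinM -!EFinD lee_fin.
    by have := AZ x z Ax Zz; rewrite [(t^-1 * _)%R]mulrC [((1 - t)^-1 * _)%R]mulrC.
  (* Off [Z] the excess is nonnegative by the triangle inequality. *)
  rewrite mule0 adde0 /sqdist /cost_fun /= -!EFinM -!EFinD lee_fin.
  have [a0 b0] := (mdist_ge0 (x : X) z, mdist_ge0 z w).
  have tri := metric_triangle (x : X) z w.
  have d0 := mdist_ge0 (x : X) w.
  have /le_trans -> // : (mdist (x : X) w ^+ 2 <= (mdist (x : X) z + mdist z w) ^+ 2)%R.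
    by rewrite ler_sqr ?nnegrE// addr_ge0.
  rewrite -subr_ge0.
  set a := mdist _ z; set b := mdist _ w.
  have -> : (t^-1 * a ^+ 2 + (1 - t)^-1 * b ^+ 2 - (a + b) ^+ 2 =
      ((1 - t) * a - t * b) ^+ 2 / (t * (1 - t)))%R.
    by field; rewrite !gt_eqF.
  by rewrite divr_ge0 ?sqr_ge0// mulr_ge0// ltW.
move=> main.
rewrite -(fineK Efin) -(fineK Ifin) in I_le F_le tau_lt main ED E0.
have I0 := W2sq_ge0 mu0 mu1; rewrite -(fineK Ifin) lee_fin in I0.
move: (fine E) (fine (W2sq mu0 mu1)) I_le F_le tau_lt main ED E0 I0.
move=> e i; rewrite -!EFinM -?EFinD -?EFinM !lee_fin => I_le F_le tau_lt main ED E0 I0.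
set G := _ * _ in main *.
have : e%:E + G <= (t * i + r + (1 + r) * ((1 - t) * i + r / (1 - t)))%:E.
  apply: (le_trans main).
  apply: (@le_trans _ _ (t^-1%:E * (t ^+ 2 * i + t * r)%:E +
      (1 - t)^-1%:E * ((1 + r) * ((1 - t) ^+ 2 * i + r))%:E)).
    by apply: leeD; apply: lee_wpmul2l => //; try exact: ltW;
      rewrite lee_fin invr_ge0 ltW.
  rewrite -!EFinM -EFinD lee_fin le_eqVlt; apply/orP; left; apply/eqP.
  by field; rewrite !gt_eqF.
rewrite -leeBrDl// -EFinB => /le_trans; apply; rewrite lee_fin.
have u0 : (0 <= r / (1 - t))%R by rewrite divr_ge0// ltW.
have -> : (r * (3 * D ^+ 2 + 5 + 2 / (1 - t)) =
  r * (3 * D ^+ 2 + 5) + 2 * (r / (1 - t)))%R by field; rewrite gt_eqF.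
move: (r / (1 - t))%R u0 => u u0.
have ru : (r * u <= u)%R by rewrite ler_piMl.
have h1 : (t * i + (1 + r) * ((1 - t) * i) <= (1 + r) * i)%R.
  have : (0 <= r * (t * i))%R by rewrite !mulr_ge0// ltW.
  lra.
have h2 : ((1 + r) * i <= (1 + r) * ((1 + r) * (e + r)))%R.
  by rewrite ler_wpM2l// addr_ge0// ltW.
have h3 : (r * e <= r * D ^+ 2)%R by rewrite ler_wpM2l// ltW.
have h4 : (r * (r * e) <= r * e)%R by rewrite ler_piMl// mulr_ge0// ltW.
have h5 : (r * r <= r)%R by rewrite ler_piMl// ltW.
have h6 : (r * (r * r) <= r)%R by rewrite (le_trans _ h5)// ler_piMl// mulr_ge0// ltW.
lra.
Qed.

End transport_excess.

(** * Renyi entropy of the intermediate measure *)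

Section entropy.
Context {R : realType} {X : completePMetricType R}.
Variable m : {measure set (borel X) -> \bar R}.
Hypothesis mmX : is_metric_measure_space m.
Local Open Scope ereal_scope.

(** This covers the case without a Lebesgue decomposition, where the density is
    [0] by default. *)
Lemma ac_density_spec (mu : probability (borel X) R) :
  [/\ measurable_fun setT (ac_density m mu),
      forall x, (0 <= ac_density m mu x)%R &
      forall B, measurable B -> \int[m]_(x in B) (ac_density m mu x)%:E <= mu B].
Proof.
rewrite /ac_density; case: xgetP => [rho _ [mus [mrho rho0 _ rhoE]]|_].
  by split => // B mB; rewrite rhoE// leeDl.
by split => // B mB; rewrite integral0.
Qed.

Lemma exists_uniform (A : set (borel X)) : measurable A -> metric_bounded A ->
  0 < m A -> exists (mu : probability (borel X) R) (rho : borel X -> R),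
  [/\ P2 mu, is_density m mu rho, metric_bounded (msupport mu), mu (~` A) = 0 &
      forall x, A x -> rho x = ((fine (m A))^-1)%R].
Proof.
move=> mA bA A0; have Aoo := mms_bounded mmX mA bA.
have [mu muE] := exists_uniform_probability (point : borel X) mA A0 Aoo.
have [x0 [r Ar]] := bA.
have muA : mu (~` A) = 0.
  by rewrite muE ?setICl ?measure0 ?mul0e//; exact: measurableC.
exists mu, (fun x => (fine (m A))^-1 * \1_A x)%R; split => //.
- exists x0; apply: (@le_lt_trans _ _ (\int[mu]_x (cst (r ^+ 2)%:E x))); last first.
    by rewrite integral_cst// [X in _ * X]probability_setT mule1 ltry.
  apply: ae_ge0_le_integral => //.
  - by move=> x _; rewrite lee_fin sqr_ge0.
  - exact: measurable_sqdist.
  - by move=> x _; rewrite lee_fin sqr_ge0.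
  exists (~` A); split => //; first exact: measurableC.
  move=> x /= nx Ax; apply: nx => _; rewrite lee_fin.
  have := Ar x Ax; rewrite ballEmdist/= metric_sym => xr.
  rewrite ler_sqr ?nnegrE ?mdist_ge0//; first exact: ltW.
  by rewrite (le_trans (mdist_ge0 _ _) (ltW xr)).
- split.
  - by apply: measurable_funM => //; exact: measurable_indic.
  - by move=> x; rewrite mulr_ge0 ?invr_ge0 ?fine_ge0.
  - move=> B mB; rewrite muE//; under eq_integral do rewrite EFinM.
    rewrite ge0_integralZl_EFin//.
    + by rewrite integral_indic// setIC muleC.
    + by apply/measurable_EFinP; exact: measurable_indic.
- exists x0, (r + 1)%R => x suppx; rewrite ballEmdist/=.
  rewrite ltNge; apply/negP => xr.
  have /= := suppx _ (open_mball x 1) (ballxx _ ltr01).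
  rewrite muE; last exact: measurable_mball.
  rewrite (_ : _ `&` _ = set0) ?measure0 ?mul0e ?ltxx//.
  rewrite -subset0 => y [xy /Ar]; rewrite !ballEmdist/= in xy *.
  by have := metric_triangle x0 y x; rewrite (metric_sym y x); lra.
- by move=> x Ax; rewrite indicE mem_set// mulr1.
Qed.

(** For the uniform measure on [A] the entropy bound of [CD0] reads
    [(1 - t) m(A)^(1/n)] on the side of [A]; the contribution of [B] is
    nonnegative and is dropped. *)
Lemma CD0_renyi_lower (N n t : R) (A B : set (borel X)) :
  CD0 m N -> (N <= n)%R -> (1 < n)%R -> (0 <= t <= 1)%R ->
  measurable A -> metric_bounded A -> 0 < m A ->
  measurable B -> metric_bounded B -> 0 < m B ->
  exists (mu0 mu1 : probability (borel X) R) pi mut,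
  [/\ coupling mu0 mu1 pi, W2_geodesic mu0 mu1 mut, mu0 (~` A) = 0, mu1 (~` B) = 0 &
    ((1 - t) * fine (m A) `^ n^-1)%R%:E <=
      \int[m]_x (ac_density m (mut t) x `^ (1 - n^-1))%:E].
Proof.
move=> cd Nn n1 /andP[t0 t1] mA bA A0 mB bB B0.
have [mu0 [rho0 [P20 [mrho0 rho0_ge0 dens0] sup0 muA rho0E]]] := exists_uniform mA bA A0.
have [mu1 [rho1 [P21 [mrho1 rho1_ge0 dens1] sup1 muB rho1E]]] := exists_uniform mB bB B0.
have [pi [mut [[cpl _] geo ren]]] := cd mu0 mu1 rho0 rho1 P20 P21
  (And3 mrho0 rho0_ge0 dens0) (And3 mrho1 rho1_ge0 dens1) sup0 sup1.
exists mu0, mu1, pi, mut; split => //.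
have := ren t n; rewrite t0 t1 => /(_ isT Nn).
rewrite /renyi n1 leeN2; apply: le_trans.
have -> : ((1 - t) * fine (m A) `^ n^-1)%R%:E =
    \int[pi]_xy (cst ((1 - t) * fine (m A) `^ n^-1)%R%:E xy).
  by rewrite integral_cst// [X in _ * X]probability_setT mule1.
have t1' : (0 <= 1 - t)%R by rewrite subr_ge0.
apply: ae_ge0_le_integral => //.
- by move=> x _; rewrite lee_fin mulr_ge0// powR_ge0.
- by move=> x _; rewrite lee_fin addr_ge0// mulr_ge0// powR_ge0.
- apply/measurable_EFinP; apply: measurable_funD.
    apply: measurable_funM => //.
    apply: (measurableT_comp (measurable_powR _)).
    by apply: measurableT_comp; [exact: mrho0|exact: measurable_fst].
  apply: measurable_funM => //.
  apply: (measurableT_comp (measurable_powR _)).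
  by apply: measurableT_comp; [exact: mrho1|exact: measurable_snd].
apply: filterS (coupling_ae_fst cpl mA muA) => -[x y] /= Ax _.
rewrite lee_fin rho0E// -[X in (X <= _)%R]addr0 lerD//; last first.
  by rewrite mulr_ge0// powR_ge0.
by rewrite -[(fine (m A))^-1%R]powR_inv1 ?fine_ge0// -powRrM mulrNN mul1r.
Qed.

End entropy.

(** * Contraction towards a point *)

Section contraction.
Context {R : realType} {X : completePMetricType R}.
Variable m : {measure set (borel X) -> \bar R}.
Hypothesis mmX : is_metric_measure_space m.
Local Open Scope ereal_scope.

(** [young_powR] with simpler coefficients, valid when the slope is at
    least [1]. *)
Lemma young_powR_weight (n s r : R) : (2 <= n)%R -> (1 <= s)%R -> (0 <= r)%R ->
  (r `^ (1 - n^-1) <= s * r + s^-1)%R.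
Proof.
move=> n2 s1 r0; have s0 : (0 < s)%R by rewrite (lt_le_trans _ s1).
have n1 : (1 < n)%R by rewrite (lt_le_trans _ n2)// ltr1n.
have n0 : (0 < n)%R by rewrite (lt_trans _ n1).
have nV1 : (n^-1 <= 1)%R by rewrite invf_le1// ltW.
apply: (le_trans (young_powR n1 s0 r0)); apply: lerD.
  rewrite ler_piMl ?mulr_ge0 ?(ltW s0)// gerBl invr_ge0 ltW//.
apply: (@le_trans _ _ (s `^ (1 - n))%R).
  by rewrite ler_piMl// powR_ge0.
rewrite -powR_inv1 ?(ltW s0)// ler_powR//; lra.
Qed.

(** The entropy is split into the part in [W], estimated with the constant
    slope [B], and the part off [W], estimated with the slope
    [la (1 + d(z, w)^2)]: the latter is small as soon as the weighted mass off
    [W] is much smaller than [la^-1], and [la] is large. *)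
Lemma renyi_le_weighted (mu : probability (borel X) R) (W : set (borel X))
    (w : X) (n B la : R) :
  (2 <= n)%R -> (0 < B)%R -> (1 <= la)%R -> measurable W ->
  \int[m]_x (ac_density m mu x `^ (1 - n^-1))%:E <=
    ((1 - n^-1) * B)%:E + (n^-1 * B `^ (1 - n))%:E * m W +
    (la%:E * \int[mu]_(z in ~` W) sqweight w z +
     la^-1%:E * \int[m]_z ((1 + mdist (z : X) w ^+ 2)^-1)%:E).
Proof.
move=> n2 B0 la1 mW; have mZ := measurableC mW.
have [] := ac_density_spec m mu; set rho := ac_density m mu => mrho rho0 rho_mu.
have la0 : (0 < la)%R by rewrite (lt_le_trans _ la1).
have n1 : (1 < n)%R by rewrite (lt_le_trans _ n2)// ltr1n.
have n0 : (0 < n)%R by rewrite (lt_trans _ n1).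
have nV : (0 <= 1 - n^-1)%R by rewrite subr_ge0 invf_le1// ltW.
have mrhoq : measurable_fun setT (fun x => (rho x `^ (1 - n^-1))%:E).
  by apply/measurable_EFinP; apply: (measurableT_comp (measurable_powR _)).
have mrhoE (S : set (borel X)) : measurable_fun S (EFin \o rho).
  by apply: measurable_funTS; exact/measurable_EFinP.
pose g (z : borel X) := (1 + mdist (z : X) w ^+ 2)%R.
have g1 z : (1 <= g z)%R by rewrite lerDl sqr_ge0.
have g0 z : (0 < g z)%R by rewrite (lt_le_trans _ (g1 z)).
have mg : measurable_fun setT g.
  apply: measurable_funD => //.
  by apply: measurable_funX; exact: measurable_mdistr.
have mgV : measurable_fun setT (fun z => ((g z)^-1)%R).
  under eq_fun do rewrite -powR_inv1 ?(ltW (g0 _))//.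
  by apply: (measurableT_comp (measurable_powR _)).
rewrite -{1}(setUv W) ge0_integral_setU//; last 3 first.
- by rewrite setUv.
- by move=> x _; rewrite lee_fin powR_ge0.
- by apply/disj_setPS; rewrite setICr.
apply: leeD.
- apply: (@le_trans _ _ (\int[m]_(x in W)
    (((1 - n^-1) * B)%:E * (rho x)%:E + (cst (n^-1 * B `^ (1 - n))%:E x)))).
    apply: ge0_le_integral => //.
    + by move=> x _; rewrite lee_fin powR_ge0.
    + exact: measurable_funTS.
    + apply: emeasurable_funD => //; apply: measurable_funeM; exact: mrhoE.
    + move=> x _; rewrite -EFinM -EFinD lee_fin -mulrA.
      exact: young_powR.
  rewrite ge0_integralD//; [|by move=> x _; rewrite mule_ge0 ?lee_fin// mulr_ge0// ltW
    |by apply: measurable_funeM; exact: mrhoE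
    |by move=> x _; rewrite lee_fin mulr_ge0 ?invr_ge0 ?powR_ge0// ltW].
  rewrite integral_cst//; apply: leeD2r.
  rewrite ge0_integralZl_EFin//; [|by move=> x _; rewrite lee_fin|by rewrite mulr_ge0// ltW].
  rewrite -[leRHS]mule1 lee_wpmul2l ?lee_fin ?mulr_ge0 ?(ltW B0)//.
  by rewrite (le_trans (rho_mu _ mW))// probability_le1.
- apply: (@le_trans _ _ (\int[m]_(x in ~` W)
    (la%:E * ((g x)%:E * (rho x)%:E) + la^-1%:E * ((g x)^-1)%:E))).
    apply: ge0_le_integral => //.
    + by move=> x _; rewrite lee_fin powR_ge0.
    + exact: measurable_funTS.
    + apply: emeasurable_funD; apply: measurable_funeM.
        apply: emeasurable_funM => //.
        by apply/measurable_EFinP; exact: measurable_funTS.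
      by apply/measurable_EFinP; exact: measurable_funTS.
    + move=> x _; rewrite -!EFinM -EFinD lee_fin mulrA -invfM.
      by apply: young_powR_weight => //; rewrite mulr_ege1.
  have mgE : measurable_fun (~` W) (EFin \o g).
    by apply/measurable_EFinP; exact: measurable_funTS.
  have mgVE : measurable_fun (~` W) (fun z => ((g z)^-1)%:E).
    by apply/measurable_EFinP; exact: measurable_funTS.
  have gr0 x : 0 <= (g x)%:E * (rho x)%:E by rewrite lee_fin mulr_ge0// ltW.
  have gV0 x : 0 <= ((g x)^-1)%:E by rewrite lee_fin invr_ge0 ltW.
  have mgr : measurable_fun (~` W) (fun x => (g x)%:E * (rho x)%:E).
    exact: emeasurable_funM.
  rewrite ge0_integralD//; [|by move=> x _; rewrite mule_ge0// lee_fin ltW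
    |exact: measurable_funeM|by move=> x _; rewrite mule_ge0// lee_fin invr_ge0 ltW
    |exact: measurable_funeM].
  rewrite ge0_integralZl_EFin//; [|exact: ltW].
  rewrite ge0_integralZl_EFin//; [|by rewrite invr_ge0 ltW].
  apply: leeD.
    apply: lee_wpmul2l; first by rewrite lee_fin ltW.
    apply: (ge0_integral_density_le (h := sqweight w)) => //.
    by move=> x _; exact: sqweight_ge0.
  apply: lee_wpmul2l; first by rewrite lee_fin invr_ge0 ltW.
  apply: ge0_subset_integral => //; first exact/measurable_EFinP.
Qed.

(** With [B = (1 - t) m(A)^(1/k)], the entropy inequality becomes
    [B <= (1 - 1/k) B + (1/k) B^(1 - k) m(W)] plus an error, that is
    [B^k <= m(W)] once the error is gone.  The error
    [la * O(r) + O(la^-1)] vanishes when first [r] tends to [0] and then [la]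
    to infinity. *)
Lemma CD0_contraction (N t e : R) (k : nat) (A W : set (borel X)) (w : X) :
  CD0 m N -> (N <= k%:R)%R -> (1 < k)%N -> (0 < t < 1)%R -> (0 < e)%R ->
  measurable A -> metric_bounded A ->
  \int[m]_z ((1 + mdist (z : X) w ^+ 2)^-1)%:E < +oo ->
  measurable W ->
  (forall x z : X, A x -> mdist x z <= t * mdist x w + e ->
     mdist z w <= (1 - t) * mdist x w + e -> W z)%R ->
  ((1 - t) ^+ k)%:E * m A <= m W.
Proof.
move=> cd Nk k1 t01 e0 mA bA Joo mW AW.
have [t0 t1] := andP t01.
have [A0|A0] := eqVneq (m A) 0; first by rewrite A0 mule0.
have {}A0 : 0 < m A by rewrite lt0e A0 measure_ge0.
have Aoo := mms_bounded mmX mA bA.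
have Afin : m A \is a fin_num by rewrite ge0_fin_numE.
pose n : R := k%:R.
have n2 : (2 <= n)%R by rewrite ler_nat.
have n1 : (1 < n)%R by rewrite ltr1n.
have n0 : (0 < n)%R by rewrite (lt_trans _ n1).
pose M := fine (m A).
have M0 : (0 < M)%R by rewrite fine_gt0// A0.
have t1' : (0 < 1 - t)%R by rewrite subr_gt0.
pose B := ((1 - t) * M `^ n^-1)%R.
have B0 : (0 < B)%R by rewrite mulr_gt0// powR_gt0.
have Bk : (B ^+ k = (1 - t) ^+ k * M)%R.
  rewrite exprMn; congr (_ * _)%R.
  by rewrite -powR_mulrn ?powR_ge0// -powRrM mulVf ?gt_eqF// powRr1// ltW.
have [x0 [r0 Ar]] := bA.
pose D := (r0 + mdist x0 w)%R.
have AD x : A x -> (mdist x w <= D)%R.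
  move=> Ax; have := Ar x Ax; rewrite ballEmdist/= => /ltW x0x.
  have := metric_triangle (x : X) x0 w; rewrite /D (metric_sym (x : X) x0); lra.
pose ka := ((e / 2) ^+ 2)%R.
have ka0 : (0 < ka)%R by rewrite exprn_gt0// divr_gt0.
pose th := (ka / (1 + ka + D ^+ 2))%R.
have th0 : (0 < th)%R by rewrite divr_gt0// ltr_wpDr ?sqr_ge0// addr_gt0.
pose c := (3 * D ^+ 2 + 5 + 2 / (1 - t))%R.
have c0 : (0 < c)%R.
  by rewrite addr_gt0 ?divr_gt0// ltr_wpDl// mulr_ge0// sqr_ge0.
have [J J0 JE] : exists2 J : R, (0 <= J)%R &
    \int[m]_z ((1 + mdist (z : X) w ^+ 2)^-1)%:E = J%:E.
  have ge0 : 0 <= \int[m]_z ((1 + mdist (z : X) w ^+ 2)^-1)%:E.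
    by apply: integral_ge0 => z _; rewrite lee_fin invr_ge0 addr_ge0// sqr_ge0.
  exists (fine (\int[m]_z ((1 + mdist (z : X) w ^+ 2)^-1)%:E)).
    exact: fine_ge0.
  by rewrite fineK// ge0_fin_numE.
have main la r : (1 <= la)%R -> (0 < r <= 1)%R ->
    B%:E <= ((1 - n^-1) * B)%:E + (n^-1 * B `^ (1 - n))%:E * m W +
      (la * (r * c / th) + J / la)%:E.
  move=> la1 /andP[rp r1].
  have la0 : (0 < la)%R by rewrite (lt_le_trans _ la1).
  have mball_w : 0 < m (ball w r).
    have : msupport m w by rewrite (mms_support mmX).
    by apply; [exact: open_mball|exact: ballxx].
  have bball : metric_bounded (ball w r) by exists w, r.
  have t01' : (0 <= t <= 1)%R by rewrite !ltW.
  have [mu0 [mu1 [pi [mut [cpl geo muA muB lowB]]]]] :=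
    CD0_renyi_lower mmX cd Nk n1 t01' mA bA A0 (measurable_mball w r) bball mball_w.
  apply: (le_trans lowB); apply: (le_trans (renyi_le_weighted _ w n2 B0 la1 mW)).
  apply: leeD2l; rewrite JE [in leRHS]EFinD [(J / la)%R]mulrC [in leRHS]EFinM.
  apply: leeD2r; rewrite EFinM lee_wpmul2l ?lee_fin ?(ltW la0)//.
  have := transport_excess_le (mms_separable mmX) geo cpl mA muA (measurableC mW)
    muB t01 _ (ltW th0) AD _.
  rewrite rp r1 => /(_ isT).
  move=> exc; rewrite muleC lee_pdivlMl//; apply: exc => x z Ax Wz.
  apply: quadratic_excess; rewrite ?mdist_ge0 ?AD//=.
  - exact: metric_triangle.
  - by move=> [xz zw]; apply: Wz; exact: (AW x).
have [Woo|Wfin] := eqVneq (m W) +oo; first by rewrite Woo leey.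
have {}Wfin : m W \is a fin_num by rewrite ge0_fin_numE// ltey.
rewrite -(fineK Afin) -(fineK Wfin) -EFinM lee_fin -/M -Bk.
move: main; rewrite -(fineK Wfin); set v := fine (m W) => main.
have : (B <= (1 - n^-1) * B + n^-1 * B `^ (1 - n) * v)%R.
  apply/ler_addgt0Pr => d d0.
  pose la := (1 + J * 2 / d)%R.
  have la1 : (1 <= la)%R by rewrite lerDl divr_ge0 ?mulr_ge0// ltW.
  have la0 : (0 < la)%R by rewrite (lt_le_trans _ la1).
  pose r := Num.min 1%R (d / 2 * th / (la * c))%R.
  have d20 : (0 < d / 2)%R by rewrite divr_gt0.
  have rp : (0 < r)%R by rewrite /r lt_min ltr01/=; apply: divr_gt0; apply: mulr_gt0.
  have r1 : (r <= 1)%R by rewrite ge_min lexx.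
  have := main la r la1; rewrite rp r1 => /(_ isT).
  rewrite -!EFinM -!EFinD lee_fin => /le_trans; apply; rewrite lerD2l.
  have e1 : (la * (r * c / th) <= d / 2)%R.
    have : (r <= d / 2 * th / (la * c))%R by rewrite ge_min lexx orbT.
    rewrite ler_pdivlMr ?mulr_gt0//.
    by rewrite !mulrA ler_pdivrMr// (mulrC la r) !mulrA.
  have e2 : (J / la <= d / 2)%R.
    rewrite ler_pdivrMr// /la mulrDr mulr1.
    have -> : (d / 2 * (J * 2 / d) = J)%R by field; rewrite gt_eqF.
    by rewrite lerDr divr_ge0// ltW.
  by rewrite [leRHS]splitr lerD.
have -> : (B `^ (1 - n) = B / B ^+ k)%R.
  rewrite powRD; last by rewrite (gt_eqF B0) implybT.
  by rewrite powRr1 ?(ltW B0)// powRN powR_mulrn// ltW.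
move=> h.
have : (n^-1 * B <= n^-1 * (B / B ^+ k * v))%R by lra.
rewrite ler_pM2l ?invr_gt0// -mulrA -[leLHS]mulr1 ler_pM2l//.
by rewrite ler_pdivlMl ?exprn_gt0// mulr1.
Qed.

End contraction.

(** * Linear volume growth *)

Section growth.
Context {R : realType} {X : completePMetricType R}.
Variable m : {measure set (borel X) -> \bar R}.
Hypothesis mmX : is_metric_measure_space m.
Local Open Scope ereal_scope.

Definition linear_growth (p : X) :=
  exists2 C : R, (0 < C)%R & forall r : R, (0 <= r)%R -> m (ball p r) <= (C * (1 + r))%:E.

Lemma le_measure_ball (x y : X) (r s : R) :
  (s + mdist x y <= r)%R -> m (ball y s) <= m (ball x r).
Proof.
move=> sr; apply: le_measure; rewrite ?inE; try exact: measurable_mball.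
move=> z; rewrite !ballEmdist /= => yz.
by have := metric_triangle x y z; lra.
Qed.

Lemma measure_ball_lty (x : X) (r : R) : m (ball x r) < +oo.
Proof. by apply: (mms_bounded mmX); [exact: measurable_mball|exists x, r]. Qed.

Lemma measure_ball_gt0 (x : X) (r : R) : (0 < r)%R -> 0 < m (ball x r).
Proof.
move=> r0; have : msupport m x by rewrite (mms_support mmX).
by apply; [exact: open_mball|exact: ballxx].
Qed.

Lemma limsup_linear_growth (p : X) (V0 : R) :
  limf_esup (fun r : R => m (ball p r) * (r^-1)%:E) +oo%R = V0%:E ->
  linear_growth p.
Proof.
move=> limV; pose V : R := (`|V0| + 1)%R.
have [A [R0 [_ R0A]] supA] : exists2 A : set R, \forall x \near +oo%R, A x &
    ereal_sup ((fun r : R => m (ball p r) * (r^-1)%:E) @` A) < V%:E.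
  have /ereal_inf_lt : limf_esup (fun r : R => m (ball p r) * (r^-1)%:E) +oo%R < V%:E.
    by rewrite limV lte_fin /V ltr_pwDr// ler_norm.
  by move=> [_ [A oA <-]]; exists A.
pose R1 : R := (Num.max R0 0 + 1)%R.
have R1R0 : (R0 < R1)%R by rewrite /R1 ltr_pwDr// le_max lexx.
have R10 : (0 < R1)%R by rewrite /R1 ltr_pwDr// le_max lexx orbT.
have V0p : (0 < V)%R by rewrite ltr_wpDl.
have M0 : (0 <= fine (m (ball p R1)))%R by rewrite fine_ge0.
exists (V + fine (m (ball p R1)))%R; first by rewrite ltr_wpDr.
move=> r r0; have [rR1|R1r] := leP r R1.
  apply: (@le_trans _ _ (m (ball p R1))).
    by apply: le_measure_ball; rewrite mdistxx addr0.
  rewrite -(@fineK _ (m (ball p R1))) ?ge0_fin_numE ?measure_ball_lty// lee_fin.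
  have Vr : (0 <= V * (1 + r))%R by rewrite mulr_ge0 ?(ltW V0p)// addr_ge0.
  have Mr := mulr_ge0 M0 r0.
  by rewrite mulrDl mulrDr mulr1; lra.
have rp : (0 < r)%R by rewrite (lt_trans R10).
have : m (ball p r) * (r^-1)%:E <= V%:E.
  apply: le_trans (ltW supA); apply: ereal_sup_ubound; exists r => //.
  by apply: R0A; rewrite (lt_trans R1R0).
rewrite lee_pdivrMr// => /le_trans; apply; rewrite -EFinM lee_fin.
apply: ler_pM => //; [exact: ltW|by rewrite lerDl|by rewrite lerDr].
Qed.

Lemma linear_growthW (p w : X) : linear_growth p -> linear_growth w.
Proof.
move=> [C C0 growth]; exists (C * (1 + mdist p w))%R.
  by rewrite mulr_gt0// ltr_pwDl// mdist_ge0.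
move=> r r0; apply: (@le_trans _ _ (m (ball p (r + mdist p w)))).
  exact: le_measure_ball.
apply: le_trans (growth _ _) _; first by rewrite addr_ge0// mdist_ge0.
rewrite lee_fin -mulrA ler_pM2l//.
have : (0 <= mdist p w * r)%R by rewrite mulr_ge0// mdist_ge0.
lra.
Qed.

(** Linear growth makes [(1 + d(z, w)^2)^-1] integrable: on the dyadic annulus
    [2^(k-1) <= d(z, w) < 2^k] it is at most [4 / 4^k], on a volume [O(2^k)]. *)
Lemma linear_growth_integral_lty (w : X) : linear_growth w ->
  \int[m]_z ((1 + mdist (z : X) w ^+ 2)^-1)%:E < +oo.
Proof.
move=> [C C0 growth].
pose f (k : nat) (z : borel X) : \bar R := ((4 / 4 ^+ k)%R * \1_(ball w (2 ^+ k)) z)%:E.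
have f0 k z : 0 <= f k z by rewrite lee_fin mulr_ge0// divr_ge0// exprn_ge0.
have mf k : measurable_fun setT (f k).
  apply/measurable_EFinP; apply: measurable_funM => //.
  by apply: measurable_indic; exact: measurable_mball.
have le_f z : ((1 + mdist (z : X) w ^+ 2)^-1)%:E <= \sum_(0 <= k <oo) f k z.
  set d := mdist _ w; have d0 : (0 <= d)%R by exact: mdist_ge0.
  have [k dk kmin] : exists2 k : nat, (d < 2 ^+ k)%R & (4^-1 * 4 ^+ k <= 1 + d ^+ 2)%R.
    have exk : exists k : nat, (d < 2 ^+ k)%R.
      exists (Num.truncn d).+1; apply: (lt_trans (Num.Theory.truncnS_gt d)).
      by rewrite -natrX ltr_nat ltn_expl.
    have [k dk kmin] := ex_minnP exk; exists k => //.
    case: k dk kmin => [_ _|k _ kmin].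
      by rewrite expr0 mulr1 (@le_trans _ _ 1%R) ?lerDl ?sqr_ge0// invf_le1// ler1n.
    have : (2 ^+ k <= d)%R.
      by rewrite leNgt; apply/negP => /kmin; rewrite ltnn.
    rewrite exprS mulrA mulVf// mul1r => kd.
    have : (4 ^+ k = (2 ^+ k) ^+ 2 :> R)%R by rewrite exprAC; congr (_ ^+ _)%R; rewrite -natrX.
    move=> ->; rewrite (@le_trans _ _ (d ^+ 2)%R) ?lerDr//.
    by rewrite ler_sqr ?nnegrE// exprn_ge0.
  apply: (@le_trans _ _ (f k z)).
    rewrite /f lee_fin indicE mem_set ?mulr1; last first.
      by rewrite ballEmdist/= metric_sym.
    rewrite -[(4 / 4 ^+ k)%R]invrK lef_pV2 ?posrE.
    - by rewrite invfM invrK.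
    - by rewrite ltr_pwDl// sqr_ge0.
    - by rewrite invr_gt0 divr_gt0// exprn_gt0.
  apply: (@le_trans _ _ (\sum_(0 <= i < k.+1) f i z)).
    rewrite big_nat_recr//= leeDr//; exact: sume_ge0.
  by apply: nneseries_lim_ge.
apply: (@le_lt_trans _ _ (\int[m]_z (\sum_(0 <= k <oo) f k z))).
  apply: ge0_le_integral => //.
  - by move=> z _; rewrite lee_fin invr_ge0 addr_ge0// sqr_ge0.
  - apply/measurable_EFinP.
    have -> : (fun z : borel X => (1 + mdist (z : X) w ^+ 2)^-1)%R =
              (fun z : borel X => (1 + mdist (z : X) w ^+ 2) `^ (-1))%R.
      by apply/funext => z; rewrite powR_inv1// addr_ge0// sqr_ge0.
    apply: (measurableT_comp (measurable_powR _)).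
    apply: measurable_funD => //; apply: measurable_funX.
    exact: measurable_mdistr.
  - exact: ge0_emeasurable_sum.
rewrite integral_nneseries//.
apply: (@le_lt_trans _ _ (16 * C)%:E); last exact: ltry.
apply: lime_le.
  by apply: is_cvg_nneseries => k _ _; exact: integral_ge0.
apply: nearW => n.
apply: (@le_trans _ _ (\sum_(0 <= k < n) (8 * C / 2 ^+ k)%:E)).
  apply: lee_sum => k _.
  have -> : \int[m]_z f k z = (4 / 4 ^+ k)%:E * m (ball w (2 ^+ k)).
    under eq_integral do rewrite /f EFinM.
    have mw := measurable_mball w (2 ^+ k).
    have mi : measurable_fun setT (fun z : borel X => (\1_(ball w (2 ^+ k)) z : R)%:E).
      by apply/measurable_EFinP; exact: measurable_indic.
    by rewrite ge0_integralZl_EFin// integral_indic// setIT.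
  apply: (@le_trans _ _ ((4 / 4 ^+ k)%:E * (C * (1 + 2 ^+ k))%:E)).
    apply: lee_wpmul2l; first by rewrite lee_fin divr_ge0// exprn_ge0.
    by apply: growth; rewrite exprn_ge0.
  rewrite -EFinM lee_fin.
  have -> : (4 ^+ k = 2 ^+ k * 2 ^+ k :> R)%R by rewrite -exprMn -natrM.
  have u1 : (1 <= 2 ^+ k :> R)%R by rewrite exprn_ege1// ler1n.
  move: (2 ^+ k : R)%R u1 => u u1.
  have u0 : (0 < u)%R by rewrite (lt_le_trans _ u1).
  rewrite ler_pdivlMr//.
  have -> : (4 / (u * u) * (C * (1 + u)) * u = 4 * C * ((1 + u) / u))%R.
    by field; rewrite gt_eqF.
  have -> : (8 * C = 4 * C * 2)%R by ring.
  rewrite ler_pM2l ?mulr_gt0// ler_pdivrMr//; lra.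
have := @geometric_le_lim R n (8 * C) (1 / 2).
rewrite sumEFin lee_fin.
have -> : (\sum_(0 <= i < n) 8 * C / 2 ^+ i = series (geometric (8 * C) (1 / 2)) n)%R.
  by apply: eq_bigr => i _; rewrite /geometric /= expr_div_n expr1n mul1r.
have -> : (8 * C / (1 - 1 / 2) = 16 * C)%R by field.
apply; first by rewrite mulr_ge0// ltW.
  by rewrite divr_gt0.
by rewrite ger0_norm ?divr_ge0//; lra.
Qed.

End growth.

(** * Busemann functions *)

Section busemann_function.
Context {R : realType} {X : completePMetricType R}.
Variable gamma : R -> X.
Hypothesis ray : geodesic_ray gamma.
Implicit Types (x y : X) (s t : R).

Local Notation b := (busemann gamma).

Lemma ray_dist s t : 0 <= s -> s <= t -> mdist (gamma s) (gamma t) = t - s.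
Proof.
move=> s0 st; rewrite ray// ?(le_trans s0)//.
by rewrite distrC ger0_norm// subr_ge0.
Qed.

Lemma busemann_approx_le x s t : 0 <= s -> s <= t ->
  s - mdist x (gamma s) <= t - mdist x (gamma t).
Proof.
move=> s0 st; have := metric_triangle x (gamma s) (gamma t).
by rewrite ray_dist//; lra.
Qed.

(** Clamping at [0] makes the approximating functions monotone on the whole
    line, since nothing is known of [gamma] on negative times. *)
Lemma busemann_cvg x :
  (t - mdist x (gamma t)) @[t --> +oo] -->
    sup (range (fun t => Num.max 0 t - mdist x (gamma (Num.max 0 t)))).
Proof.
have : (Num.max 0 t - mdist x (gamma (Num.max 0 t))) @[t --> +oo] -->
    sup (range (fun t => Num.max 0 t - mdist x (gamma (Num.max 0 t)))).
  apply: nondecreasing_cvgr.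
    move=> s t st; apply: busemann_approx_le; first by rewrite le_max lexx.
    by rewrite ge_max le_max lexx/= le_max st orbT.
  exists (mdist (gamma 0) x) => _ [t _ <-].
  have t0 : 0 <= Num.max 0 t by rewrite le_max lexx.
  have := metric_triangle (gamma 0) x (gamma (Num.max 0 t)).
  by rewrite ray_dist//; lra.
move=> cvg_max; apply: cvg_trans cvg_max; apply: near_eq_cvg.
near=> t; rewrite max_r//.
Unshelve. all: by end_near. Qed.

Lemma busemann_ge_approx x t : 0 <= t -> t - mdist x (gamma t) <= b x.
Proof.
move=> t0; rewrite /busemann; apply: limr_ge.
  by apply/cvg_ex; eexists; exact: busemann_cvg.
near=> s; apply: busemann_approx_le => //.
Unshelve. all: by end_near. Qed.

Lemma busemann_near x r : r < b x -> exists2 T, 0 <= T &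
  forall t, T <= t -> r < t - mdist x (gamma t).
Proof.
move=> rb.
have cb : (t - mdist x (gamma t)) @[t --> +oo] --> b x.
  by apply/cvg_ex; eexists; exact: busemann_cvg.
have [T [_ Tr]] : \forall t \near +oo, r < t - mdist x (gamma t).
  exact: (cvgr_gt _ cb _ rb).
exists (Num.max 0 T + 1).
  by rewrite addr_ge0// le_max lexx.
move=> t Tt; apply: Tr; apply: lt_le_trans Tt.
by rewrite ltr_pwDr// le_max lexx orbT.
Qed.

Lemma busemann_lipschitz x y : b x <= b y + mdist x y.
Proof.
apply/ler_addgt0Pr => e e0.
have [|T T0 Tx] := @busemann_near x (b x - e); first by rewrite gtrBl.
have := Tx T (lexx _); have := busemann_ge_approx y T0.
by have := metric_triangle y x (gamma T); rewrite (metric_sym y x); lra.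
Qed.

Lemma busemann_ray s : 0 <= s -> b (gamma s) = s.
Proof.
move=> s0; apply/eqP; rewrite eq_le; apply/andP; split; last first.
  by have := busemann_ge_approx (gamma s) s0; rewrite mdistxx subr0.
apply/ler_addgt0Pr => e e0.
have [|T T0 Tx] := @busemann_near (gamma s) (b (gamma s) - e); first by rewrite gtrBl.
have Ts : T <= Num.max T s by rewrite le_max lexx.
have sT : s <= Num.max T s by rewrite le_max lexx orbT.
by have := Tx _ Ts; rewrite ray_dist//; lra.
Qed.

(** Walking from [x] towards a far point [gamma T] raises [b] at almost unit
    speed; this replaces an asymptotic ray from [x], and needs no compactness. *)
Lemma exists_uphill (geoX : is_geodesic_space X) x s e : 0 <= s -> 0 < e ->
  exists y, [/\ mdist x y <= s, b y <= b x + s & b x + s - e <= b y].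
Proof.
move=> s0 e0.
have [|T T0 Tx] := @busemann_near x (b x - e); first by rewrite gtrBl.
pose T1 := T + s + mdist (gamma 0) x + 1.
have T1T : T <= T1 by rewrite /T1; have := mdist_ge0 (gamma 0) x; lra.
have T10 : 0 <= T1 by rewrite (le_trans T0).
pose L := mdist x (gamma T1).
have sL : s < L.
  have := metric_triangle (gamma 0) x (gamma T1).
  by rewrite ray_dist// /L /T1; lra.
have L0 : 0 < L by rewrite (le_lt_trans s0).
have [c [c0 c1 cgeo]] := geoX x (gamma T1).
have sL01 : 0 <= s / L <= 1.
  by rewrite divr_ge0 ?(ltW L0)//= ler_pdivrMr// mul1r ltW.
have xy : mdist x (c (s / L)) = s.
  rewrite -{1}c0 cgeo ?lexx ?ler01// sub0r normrN -/L ger0_norm.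
    by rewrite divfK// gt_eqF.
  by case/andP: sL01.
have yT : mdist (c (s / L)) (gamma T1) = L - s.
  rewrite -{1}c1 cgeo ?lexx ?ler01// -/L distrC ger0_norm.
    by rewrite mulrBl mul1r divfK// gt_eqF.
  by rewrite subr_ge0; case/andP: sL01.
exists (c (s / L)); split; first by rewrite xy.
  by have := busemann_lipschitz (c (s / L)) x; rewrite metric_sym xy.
have := busemann_ge_approx (c (s / L)) T10; rewrite yT.
by have := Tx _ T1T; rewrite -/L; lra.
Qed.

End busemann_function.

(** * Volume carried along a Busemann function *)

Lemma bernoulli_ge (R : realDomainType) (t : R) (k : nat) : 0 <= t <= 1 ->
  1 - k%:R * t <= (1 - t) ^+ k.
Proof.
move=> /andP[t0 t1]; elim: k => [|k IH]; first by rewrite mul0r subr0 expr0.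
rewrite exprS -natr1.
have u0 : 0 <= 1 - t by rewrite subr_ge0.
apply: le_trans (ler_wpM2l u0 IH).
have : 0 <= k%:R * (t * t) by rewrite !mulr_ge0.
lra.
Qed.

Section volume.
Context {R : realType} {X : completePMetricType R}.
Variables (m : {measure set (borel X) -> \bar R}) (N : R) (k : nat) (gamma : R -> X).
Hypothesis mmX : is_metric_measure_space m.
Hypotheses (cd : CD0 m N) (Nk : (N <= k%:R)%R) (k1 : (1 < k)%N).
Hypothesis ray : geodesic_ray gamma.
Local Notation p := (gamma 0).
Local Notation b := (busemann gamma).
Hypothesis growth : linear_growth m p.
Local Open Scope ereal_scope.

Let weight_lty (w : X) : \int[m]_z ((1 + mdist (z : X) w ^+ 2)^-1)%:E < +oo.
Proof. by apply: linear_growth_integral_lty; exact: linear_growthW growth. Qed.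

Let fin_bounded (A : set (borel X)) : measurable A -> metric_bounded A ->
  m A \is a fin_num.
Proof. by move=> mA bA; rewrite ge0_fin_numE// (mms_bounded mmX). Qed.

(** Contracting [ball y D] towards its centre gives a ball comparison of
    Bishop-Gromov type, up to the factor [2^k]. *)
Lemma ball_volume_lower (y : X) (e D : R) : (0 < e)%R -> (e <= D)%R ->
  ((e / (2 * D)) ^+ k)%:E * m (ball y D) <= m (ball y e).
Proof.
move=> e0 eD; have D0 : (0 < D)%R by rewrite (lt_le_trans e0).
have -> : (e / (2 * D) = 1 - (1 - e / (2 * D)))%R by rewrite subKr.
have u0 : (0 < e / (2 * D))%R by rewrite divr_gt0// mulr_gt0.
have u1 : (e / (2 * D) < 1)%R by rewrite ltr_pdivrMr ?mulr_gt0//; lra.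
apply: (@CD0_contraction _ _ _ mmX N _ (e / 4) k _ _ y) => //.
- by apply/andP; split; lra.
- by rewrite divr_gt0.
- exact: measurable_mball.
- by exists y, D.
- exact: measurable_mball.
move=> x z; rewrite !ballEmdist /= => yx _; rewrite subKr => zy.
rewrite metric_sym in yx; rewrite metric_sym.
have : (e / (2 * D) * mdist x y <= e / (2 * D) * D)%R by rewrite ler_pM2l// ltW.
have -> : (e / (2 * D) * D = e / 2)%R by field; rewrite gt_eqF.
by move=> h; apply: (le_lt_trans zy); lra.
Qed.

Definition slab (u v : R) : set (borel X) := [set x : X | (u < b x <= v)%R].

Lemma measurable_busemann : measurable_fun setT (b : borel X -> R).
Proof. by apply: lipschitz_measurable; exact: busemann_lipschitz. Qed.

Lemma measurable_slab u v : measurable (slab u v).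
Proof.
have := measurable_busemann measurableT (measurable_itv `]u, v]).
rewrite setTI; congr measurable.
Qed.

(** Bounded pieces that exhaust the slab [a < b <= a + 1].  The lower bound on
    [b] is imposed through its approximation at time [i], so that it holds
    uniformly on the piece for the approximations at all later times. *)
Definition core (a : R) (i : nat) : set (borel X) :=
  [set x : X | (a < i%:R - mdist x (gamma i%:R))%R /\ (b x <= a + 1)%R] `&` ball p i%:R.

Lemma measurable_core a i : measurable (core a i).
Proof.
apply: measurableI; last exact: measurable_mball.
rewrite (_ : [set _ | _] = [set x : X | mdist x (gamma i%:R) < i%:R - a]%R `&`
    (b @^-1` `]-oo, (a + 1)%R])%classic); last first.
  apply/seteqP; split => x /=; rewrite in_itv/=; first by case=> ? ->; split=> //; lra.
  by case=> ? ->; split=> //; lra.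
apply: measurableI.
  apply: open_borel; apply: lipschitz_lt_open => x y.
  by rewrite addrC; exact: metric_triangle.
have := measurable_busemann measurableT (measurable_itv `]-oo, (a + 1)%R]).
by rewrite setTI.
Qed.

Lemma bounded_core a i : metric_bounded (core a i).
Proof. by exists p, i%:R => x []. Qed.

Lemma metric_bounded_sub (A B : set X) : A `<=` B -> metric_bounded B -> metric_bounded A.
Proof. by move=> AB [x [r Br]]; exists x, r => y /AB /Br. Qed.

(** Contracting the core towards [gamma T] by the proportion [t = s / T] moves
    its points by [s] and raises [b] by [s], with errors that vanish as [T]
    tends to infinity; so does the loss of volume, at most
    [1 - (1 - t)^k <= k t]. *)
Lemma core_flow a i s h : (0 < s)%R -> (0 < h)%R ->
  m (core a i) <= m (slab (a + s - h) (a + s + 1 + h) `&` ball p (i%:R + s + h)).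
Proof.
move=> s0 h0; set W := _ `&` _.
have mW : measurable W.
  by apply: measurableI; [exact: measurable_slab|exact: measurable_mball].
have bW : metric_bounded W by apply: metric_bounded_sub (@subIsetr _ _ _) _; exists p, (i%:R + s + h)%R.
have Cfin := fin_bounded (measurable_core a i) (bounded_core a i).
have Wfin := fin_bounded mW bW.
rewrite -(fineK Cfin) -(fineK Wfin) lee_fin.
have M0 : (0 <= fine (m (core a i)))%R by rewrite fine_ge0.
set M := fine (m (core a i)) in M0 *.
apply/ler_addgt0Pr => e e0.
(* [T1] makes the displacement errors at most [h / 2], and [T2] makes the
   volume loss at most [e]. *)
pose T1 := (2 * s * (`|a| + i%:R + 1) / h)%R.
pose T2 := (k%:R * s * M / e)%R.
have a0 : (0 <= `|a|)%R by [].
have i0 : (0 <= i%:R :> R)%R by [].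
have T10 : (0 <= T1)%R by rewrite divr_ge0 ?(ltW h0)// !mulr_ge0 ?(ltW s0)// !addr_ge0.
have T20 : (0 <= T2)%R by rewrite divr_ge0 ?(ltW e0)// !mulr_ge0 ?(ltW s0).
pose T := (i%:R + s + 1 + T1 + T2)%R.
have T0 : (0 < T)%R by rewrite /T; lra.
have iT : (i%:R <= T)%R by rewrite /T; lra.
have sT : (s < T)%R by rewrite /T; lra.
pose t := (s / T)%R.
have tT : (t * T = s)%R by rewrite /t divfK// gt_eqF.
have t0 : (0 < t)%R by rewrite divr_gt0.
have t1 : (t < 1)%R by rewrite /t ltr_pdivrMr// mul1r.
have tai : (t * (`|a| + i%:R) <= h / 2)%R.
  rewrite /t mulrAC ler_pdivrMr//.
  have -> : (h / 2 * T = h / 2 * (i%:R + s + 1 + T2) + s * (`|a| + i%:R + 1))%R.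
    by rewrite /T /T1; field; rewrite gt_eqF.
  have : (0 <= h / 2 * (i%:R + s + 1 + T2))%R.
    by rewrite mulr_ge0 ?divr_ge0 ?(ltW h0)// !addr_ge0// ltW.
  by have := ltW s0; lra.
have ktM : (k%:R * t * M <= e)%R.
  rewrite /t mulrA mulrAC ler_pdivrMr//.
  have -> : (e * T = e * (i%:R + s + 1 + T1) + k%:R * s * M)%R.
    by rewrite /T /T2; field; rewrite gt_eqF.
  by rewrite lerDr mulr_ge0 ?(ltW e0)// !addr_ge0// ltW.
have contr : ((1 - t) ^+ k)%:E * m (core a i) <= m W.
  apply: (@CD0_contraction _ _ _ mmX N _ (h / 4) k _ _ (gamma T)) => //.
  - by rewrite t0 t1.
  - by rewrite divr_gt0.
  - exact: measurable_core.
  - exact: bounded_core.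
  move=> x z [[ax xb]]; rewrite ballEmdist/= => xp xz zT.
  have aT : (mdist (x : X) (gamma T) < T - a)%R.
    by have := busemann_approx_le ray x i0 iT; lra.
  have Tp : (mdist (x : X) (gamma T) <= i%:R + T)%R.
    have := metric_triangle (x : X) p (gamma T).
    by rewrite (ray_dist ray)// ?(ltW T0)// subr0 (metric_sym (x : X) p); lra.
  have t1' : (0 < 1 - t)%R by rewrite subr_gt0.
  have zT' : ((1 - t) * mdist (x : X) (gamma T) <= (1 - t) * (T - a))%R.
    by rewrite ler_pM2l// ltW.
  have xz' : (t * mdist (x : X) (gamma T) <= t * (i%:R + T))%R by rewrite ler_pM2l.
  have bz1 := busemann_ge_approx ray z (ltW T0).
  have bz2 := busemann_lipschitz ray z x.
  have zp := metric_triangle p (x : X) z.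
  have ta : (t * `|a| <= h / 2)%R.
    have : (0 <= t * i%:R)%R by rewrite mulr_ge0// ltW.
    by move: tai; rewrite mulrDr; lra.
  have ti : (t * i%:R <= h / 2)%R.
    have : (0 <= t * `|a|)%R by rewrite mulr_ge0// ltW.
    by move: tai; rewrite mulrDr; lra.
  have taa : (t * a <= t * `|a|)%R by rewrite ler_pM2l// ler_norm.
  rewrite (metric_sym z x) in bz2.
  have E1 : ((1 - t) * (T - a) = T - a - s + t * a)%R by rewrite -tT; ring.
  have E2 : (t * (i%:R + T) = t * i%:R + s)%R by rewrite -tT; ring.
  rewrite E1 in zT'; rewrite E2 in xz'.
  split; last by rewrite ballEmdist/=; lra.
  by apply/andP; split; lra.
rewrite -(fineK Cfin) -(fineK Wfin) -EFinM lee_fin -/M in contr.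
have t01 : (0 <= t <= 1)%R by rewrite !ltW.
have := ler_wpM2r M0 (bernoulli_ge k t01).
by rewrite mulrBl mul1r; lra.
Qed.

Lemma slabD u v w (G : set (borel X)) : (u <= v)%R -> (v <= w)%R -> measurable G ->
  m (slab u w `&` G) = m (slab u v `&` G) + m (slab v w `&` G).
Proof.
move=> uv vw mG; rewrite -measureU.
- congr (m _); rewrite -setIUl; congr (_ `&` _); apply/seteqP; split => x /=.
    move=> /andP[ux xw]; have [xv|vx] := leP (b x) v; [left|right].
      by apply/andP.
    by apply/andP.
  by move=> [|] /andP[h1 h2]; apply/andP; split => //; lra.
- by apply: measurableI => //; exact: measurable_slab.
- by apply: measurableI => //; exact: measurable_slab.
- rewrite -subset0 => x /= [[/andP[_ xv] _] [/andP[vx _] _]].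
  by move: vx; rewrite ltNge xv.
Qed.

(** The shifted copies of the core at heights [c], [c + h], ... are disjoint as
    soon as the step [h] exceeds [1], the height of the core. *)
Lemma core_sweep a i c h rad (J : nat) : (a <= c)%R -> (1 < h)%R ->
  (i%:R + (c - a) + J%:R * h <= rad)%R ->
  J%:R%:E * m (core a i) <= m (slab c (c + J%:R * h) `&` ball p rad).
Proof.
move=> ac h1; elim: J => [|J IH] rad_ge; first by rewrite mul0e.
have h0 : (0 < h)%R by rewrite (lt_trans _ h1).
have Jh : (0 <= J%:R * h)%R by rewrite mulr_ge0// ltW.
have E : (J.+1%:R * h = J%:R * h + h)%R by rewrite -natr1 mulrDl mul1r.
rewrite E in rad_ge *.
rewrite -natr1 EFinD ge0_muleDl ?lee_fin// mul1e.
rewrite (@slabD _ (c + J%:R * h)%R); [|lra|lra|exact: measurable_mball].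
apply: leeD; first by apply: IH; lra.
have := @core_flow a i (c + J%:R * h - a + (h - 1) / 2)%R ((h - 1) / 2)%R.
have -> : (a + (c + J%:R * h - a + (h - 1) / 2) - (h - 1) / 2 = c + J%:R * h)%R by ring.
have -> : (a + (c + J%:R * h - a + (h - 1) / 2) + 1 + (h - 1) / 2 = c + (J%:R * h + h))%R.
  by field.
move=> flow; apply: (le_trans (flow _ _)); [lra|lra|].
apply: le_measure; rewrite ?inE.
- by apply: measurableI; [exact: measurable_slab|exact: measurable_mball].
- by apply: measurableI; [exact: measurable_slab|exact: measurable_mball].
- apply: setIS => x; rewrite !ballEmdist/= => px; lra.
Qed.

(** [J] disjoint copies of a core fit in a ball of radius [O(J)], whose volume
    is [O(J)] with a constant independent of the core. *)
Lemma core_bounded : exists C : R, forall a i, m (core a i) <= C%:E.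
Proof.
have [C C0 Cgrowth] := growth.
exists (2 * C)%R => a i.
rewrite -(fineK (fin_bounded (measurable_core a i) (bounded_core a i))).
set M := fine _; rewrite lee_fin leNgt; apply/negP => MC.
have MJ (J : nat) : (J%:R * M <= C * (1 + i%:R) + 2 * C * J%:R)%R.
  rewrite -lee_fin EFinM (fineK (fin_bounded (measurable_core a i) (bounded_core a i))).
  have h2 : (1 < 2 :> R)%R by rewrite ltr1n.
  have := @core_sweep a i a 2%R (i%:R + J%:R * 2)%R J (lexx _) h2.
  rewrite subrr addr0 lexx => /(_ isT) /le_trans; apply.
  apply: (@le_trans _ _ (m (ball p (i%:R + J%:R * 2)%R))).
    apply: le_measure; rewrite ?inE//; try exact: measurable_mball.
    by apply: measurableI; [exact: measurable_slab|exact: measurable_mball].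
  apply: (le_trans (Cgrowth _ _)); first by rewrite addr_ge0// mulr_ge0.
  by rewrite lee_fin le_eqVlt; apply/orP; left; apply/eqP; ring.
have d0 : (0 < M - 2 * C)%R by rewrite subr_gt0.
have := MJ (Num.truncn (C * (1 + i%:R) / (M - 2 * C))).+1.
have := Num.Theory.truncnS_gt (C * (1 + i%:R) / (M - 2 * C))%R.
rewrite ltr_pdivrMr//; lra.
Qed.

Lemma slab_le_of_core a (C : \bar R) : (forall i, m (core a i) <= C) ->
  m (slab a (a + 1)) <= C.
Proof.
move=> coreC.
have -> : slab a (a + 1) = \bigcup_i core a i.
  apply/seteqP; split => [x /andP[ax xa]|x [i _ [[ax xa] px]]]; last first.
    apply/andP; split => //; apply: (lt_le_trans ax).
    exact: busemann_ge_approx.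
  have [T T0 Tx] := busemann_near ray ax.
  exists (Num.truncn (T + mdist p x)).+1 => //.
  have := Num.Theory.truncnS_gt (T + mdist p x)%R.
  set i := (_.+1) => iT; have d0 := mdist_ge0 p x.
  split; last by rewrite ballEmdist/=; lra.
  by split => //; apply: Tx; lra.
have nd_core : nondecreasing_seq (core a).
  move=> i j ij; apply/subsetPset => x [[ax xb] px].
  have ijR : (i%:R <= j%:R :> R)%R by rewrite ler_nat.
  have i0 : (0 <= i%:R :> R)%R by [].
  have := busemann_approx_le ray x i0 ijR.
  rewrite ballEmdist/= in px.
  by move=> ?; split; [split => //; lra|rewrite ballEmdist/=; lra].
have cvg_core := nondecreasing_cvg_mu (mu := m) (measurable_core a)
  (bigcup_measurable (fun i _ => measurable_core a i)) nd_core.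
rewrite -(cvg_lim _ cvg_core)//.
apply: lime_le; last by apply: nearW => i; exact: coreC.
by apply/cvg_ex; eexists; exact: cvg_core.
Qed.

End volume.

(** * Distance to the origin of the ray *)

Section level_sets.
Context {R : realType} {X : completePMetricType R}.
Variables (m : {measure set (borel X) -> \bar R}) (N : R) (k : nat) (gamma : R -> X).
Hypothesis mmX : is_metric_measure_space m.
Hypotheses (cd : CD0 m N) (Nk : (N <= k%:R)%R) (k1 : (1 < k)%N).
Hypothesis ray : geodesic_ray gamma.
Local Notation p := (gamma 0).
Local Notation b := (busemann gamma).
Local Notation slab := (slab gamma).
Local Notation core := (core gamma).
Hypothesis growth : linear_growth m p.
Local Open Scope ereal_scope.

Let mslab := measurable_slab ray.
Let mcore := measurable_core ray.

Lemma slab0_gt0 : 0 < m (slab 0 1).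
Proof.
apply: (@lt_le_trans _ _ (m (ball (gamma 2^-1) 2^-1))).
  by apply: (measure_ball_gt0 mmX); rewrite invr_gt0.
apply: le_measure; rewrite ?inE; [exact: measurable_mball|exact: mslab|].
move=> x; rewrite ballEmdist /= => gx.
have := busemann_lipschitz ray x (gamma 2^-1).
have := busemann_lipschitz ray (gamma 2^-1) x.
rewrite (busemann_ray ray) ?invr_ge0// (metric_sym x) => h1 h2.
by apply/andP; split; lra.
Qed.

Lemma exists_slab_sup : exists al : R,
  [/\ (0 < al)%R, forall a, m (slab a (a + 1)) <= al%:E &
      forall de, (0 < de)%R -> exists a i, (al - de)%:E < m (core a i)].
Proof.
have [C coreC] := core_bounded mmX cd Nk k1 ray growth.
pose S := [set m (core ai.1 ai.2) | ai in [set: R * nat]].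
have S_ub a i : m (core a i) <= ereal_sup S.
  by apply: ereal_sup_ubound; exists (a, i).
have slab_S a : m (slab a (a + 1)) <= ereal_sup S.
  by apply: (slab_le_of_core ray).
have S_le : ereal_sup S <= C%:E by apply: ge_ereal_sup => _ [ai _ <-].
have S_gt0 : 0 < ereal_sup S.
  by apply: (lt_le_trans slab0_gt0); have := slab_S 0%R; rewrite add0r.
have Sfin : ereal_sup S \is a fin_num.
  by rewrite ge0_fin_numE ?(ltW S_gt0)// (le_lt_trans S_le)// ltry.
exists (fine (ereal_sup S)); split.
- by rewrite fine_gt0// S_gt0 -ge0_fin_numE ?(ltW S_gt0).
- by move=> a; rewrite fineK.
- move=> de de0; have [_ [[a i] _ <-] lt] := ub_ereal_sup_adherent de0 Sfin.
  by exists a, i; rewrite EFinB fineK.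
Qed.

Lemma slab_le_mul al u (J : nat) : (forall a, m (slab a (a + 1)) <= al%:E) ->
  m (slab u (u + J%:R)) <= (J%:R * al)%:E.
Proof.
move=> slab1; elim: J => [|J IH].
  rewrite mul0r addr0 (_ : slab u u = set0) ?measure0//.
  by rewrite -subset0 => x /= /andP[h1 h2]; have := lt_le_trans h1 h2; rewrite ltxx.
rewrite -natr1 -[slab _ _]setIT (@slabD _ _ m _ ray _ (u + J%:R)%R)//.
- by rewrite !setIT mulrDl mul1r EFinD leeD// addrA.
- by rewrite lerDl.
- by rewrite lerD2l lerDl.
Qed.

(** The slab from [u] to [u + J] has volume at most [J al], and the copies of
    the core fill [(J - 1) (al - de)] of it: the step [J / (J - 1)] of the
    sweep exceeds [1] and gives exactly [J - 1] copies. *)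
Lemma ball_off_core_le al de a i (y : X) r u (J : nat) :
  (forall a, m (slab a (a + 1)) <= al%:E) -> (al - de)%:E <= m (core a i) ->
  (0 <= de)%R -> (a <= u)%R -> (1 < J)%N ->
  (u + r <= b y)%R -> (b y + r <= u + J%:R)%R ->
  (i%:R + (u - a) + J%:R + r <= mdist p y)%R ->
  m (ball y r) <= (al + J%:R * de)%:E.
Proof.
move=> slab1 le_core de0 au J1 ub bu far.
pose rad : R := (i%:R + (u - a) + J%:R)%R.
pose G := ball p rad.
have mG : measurable (G : set (borel X)) by exact: measurable_mball.
have mB : measurable (ball y r : set (borel X)) by exact: measurable_mball.
have mS := mslab u (u + J%:R).
pose h : R := (J%:R / J.-1%:R)%R.
have J1R : (0 < J.-1%:R :> R)%R by rewrite ltr0n; lia.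
have JE : (J%:R = J.-1%:R + 1 :> R)%R by rewrite natr1 prednK// ltnW.
have hJ : (J.-1%:R * h = J%:R)%R by rewrite /h mulrC divfK// gt_eqF.
have h1 : (1 < h)%R by rewrite /h ltr_pdivlMr// mul1r JE ltrDl.
have sweep := @core_sweep _ _ m N k gamma mmX cd Nk k1 ray growth a i u h rad J.-1 au h1.
rewrite hJ lexx in sweep; have {}sweep := sweep isT.
have disj : ball y r `&` (slab u (u + J%:R) `&` G) = set0.
  rewrite -subset0 => x [yx [_ px]]; rewrite /G !ballEmdist/= in yx px.
  by have := metric_triangle p x y; rewrite (metric_sym x y) /rad in px *; lra.
have sub : ball y r `|` (slab u (u + J%:R) `&` G) `<=` slab u (u + J%:R).
  move=> x [|[]//]; rewrite ballEmdist/= => yx.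
  have := busemann_lipschitz ray x y; have := busemann_lipschitz ray y x.
  by rewrite (metric_sym x y) => ? ?; apply/andP; split; lra.
have : m (ball y r) + m (slab u (u + J%:R) `&` G) <= (J%:R * al)%:E.
  rewrite -measureU//; last exact: measurableI.
  apply: le_trans (slab_le_mul u J slab1).
  by apply: le_measure; rewrite ?inE//; apply: measurableU => //; exact: measurableI.
move=> total.
have low : (J.-1%:R * (al - de))%:E <= m (slab u (u + J%:R) `&` G).
  by apply: le_trans sweep; rewrite EFinM; apply: lee_wpmul2l.
have Bfin : m (ball y r) \is a fin_num.
  by rewrite ge0_fin_numE// (measure_ball_lty mmX).
have := le_trans (leeD2l (m (ball y r)) low) total.
rewrite -(fineK Bfin) -EFinD !lee_fin => {}total.
apply: (@le_trans _ _ (al + J.-1%:R * de)%R).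
  by rewrite JE mulrBr mulrDl in total; lra.
by rewrite lerD2l ler_wpM2r// ler_nat leq_pred.
Qed.

(** About [D / 2] copies of a core of positive volume, taken with step [2],
    fit in [ball p D]. *)
Lemma linear_lower_growth : exists c D1 : R, (0 < c)%R /\
  forall D, (D1 <= D)%R -> (c * D)%:E <= m (ball p D).
Proof.
have [al [al0 _ core_al]] := exists_slab_sup.
have [a [i]] := core_al al al0; rewrite subrr => core0.
have cfin : m (core a i) \is a fin_num.
  rewrite ge0_fin_numE//; apply: (mms_bounded mmX); first exact: mcore.
  exact: bounded_core.
pose mu := fine (m (core a i)).
have mu0 : (0 < mu)%R by rewrite fine_gt0// core0 -ge0_fin_numE.
exists (mu / 4)%R, (2 * i%:R + 4)%R; split; first by rewrite divr_gt0.
move=> D DD; have i0 : (0 <= i%:R :> R)%R by [].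
have q0 : (0 <= (D - i%:R) / 2)%R by rewrite divr_ge0//; lra.
pose J := Num.truncn ((D - i%:R) / 2)%R.
have J_le : (J%:R <= (D - i%:R) / 2)%R by rewrite truncn_le.
have J_gt := Num.Theory.truncnS_gt ((D - i%:R) / 2)%R.
rewrite -/J -(natr1 J) in J_gt.
have h2 : (1 < 2 :> R)%R by rewrite ltr1n.
have := @core_sweep _ _ m N k gamma mmX cd Nk k1 ray growth a i a 2%R D J (lexx _) h2.
rewrite subrr addr0 => /(_ _) sweep.
apply: (@le_trans _ _ (J%:R%:E * m (core a i))).
  rewrite -(fineK cfin) -EFinM lee_fin -/mu.
  have DJ : (D / 4 <= J%:R)%R by lra.
  by have := ler_wpM2r (ltW mu0) DJ; lra.
apply: (le_trans (sweep _)); first by lra.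
apply: le_measure; rewrite ?inE//; try exact: measurable_mball.
by apply: measurableI; [exact: mslab|exact: measurable_mball].
Qed.

(** For a point [x] at distance [D] violating the estimate, the walk of length
    [s = max 0 (- b x) + 2 f D] reaches a height of at least [2 f D - 1], so
    the ball of radius [f D] lies above the core; and the distance to [p]
    still exceeds the height by [D - |b x| - 4 f D], so this ball misses the
    copies of the core. *)
Lemma mdist_le_busemann (e : R) : (0 < e)%R -> (e < 1)%R -> exists C : R,
  forall x : X, ((1 - e) * mdist p x <= `|b x| + C)%R.
Proof.
move=> e0 e1; pose f : R := (e / 12)%R.
have f0 : (0 < f)%R by rewrite divr_gt0.
have f1 : (f <= 1 / 12)%R by rewrite /f; lra.
have [al [al0 slab1 core_al]] := exists_slab_sup.
have [c [D1 [c0 lowD]]] := linear_lower_growth.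
pose q : R := ((f / 6) ^+ k)%R.
have q0 : (0 < q)%R by rewrite exprn_gt0// divr_gt0.
pose de : R := (q * c / 2)%R.
have de0 : (0 < de)%R by rewrite divr_gt0// mulr_gt0.
have [a [i core_ai]] := core_al de de0.
have i0 : (0 <= i%:R :> R)%R by [].
(* The last two terms make [f D] exceed the height of the core and [de D]
   exceed [al], which is the final contradiction. *)
pose C : R := (i%:R + `|a| + 2 + `|D1| + (`|a| + 1) / f + al / de)%R.
exists C => x; rewrite leNgt; apply/negP => lt_far.
set D := mdist p x in lt_far *.
have far : (`|b x| + C + 12 * f * D < D)%R.
  have : (12 * f = e)%R by rewrite /f; field.
  by move=> ->; lra.
have aD : (0 <= `|a|)%R by []. have D1D : (0 <= `|D1|)%R by [].
have af0 : (0 <= (`|a| + 1) / f)%R by rewrite divr_ge0 ?(ltW f0)// addr_ge0.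
have ad0 : (0 <= al / de)%R by rewrite divr_ge0// ltW.
have bx0 : (0 <= `|b x|)%R by [].
have D0 : (0 <= D)%R by exact: mdist_ge0.
have fD0 : (0 <= f * D)%R by rewrite mulr_ge0// ltW.
have CD : (C <= D)%R by lra.
have fD : (`|a| + 1 <= f * D)%R.
  have : ((`|a| + 1) / f <= D)%R by apply: le_trans CD; rewrite /C; lra.
  by rewrite ler_pdivrMr// mulrC.
have deD : (al < D * de)%R.
  by rewrite -ltr_pdivrMr//; apply: lt_le_trans CD; rewrite /C; lra.
have D1le : (D1 <= D)%R.
  by apply: le_trans CD; have := ler_norm D1; rewrite /C; lra.
have D2 : (2 <= D)%R by apply: le_trans CD; rewrite /C; lra.
have Dp : (0 < D)%R by lra.
pose s : R := (Num.max 0 (- b x) + 2 * (f * D))%R.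
have sE : (b x + 2 * Num.max 0 (- b x) = `|b x|)%R.
  have [bx|bx] := leP 0%R (b x).
    by rewrite ger0_norm// max_l; lra.
  by rewrite ltr0_norm// max_r; lra.
have max0 : (0 <= Num.max 0 (- b x))%R by rewrite le_max lexx.
have maxb : (- b x <= Num.max 0 (- b x))%R by rewrite le_max lexx orbT.
have max_le : (Num.max 0 (- b x) <= `|b x|)%R by rewrite ge_max bx0 -normrN ler_norm.
have s0 : (0 <= s)%R by rewrite /s; lra.
have [y [xy by_le by_ge]] := exists_uphill ray (mms_geodesic mmX) x s0 ltr01.
have py1 : (D - s <= mdist p y)%R.
  by have := metric_triangle p y x; rewrite (metric_sym y) -/D; lra.
have py2 : (mdist p y <= 2 * D)%R.
  by have := metric_triangle p x y; rewrite -/D /s in xy *; rewrite /C in far; lra.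
pose r : R := (f * D)%R.
have r0 : (0 < r)%R by rewrite mulr_gt0.
pose J := (Num.truncn (2 * r)%R).+1.
have r20 : (0 <= 2 * r)%R by rewrite mulr_ge0// ltW.
have J_gt : (2 * r < J%:R)%R by exact: Num.Theory.truncnS_gt.
have J_le : (J%:R <= 2 * r + 1)%R by rewrite /J -natr1 lerD2r truncn_le.
have J1 : (1 < J)%N.
  rewrite -(ltr_nat R); apply: le_lt_trans J_gt; rewrite /r; lra.
have fDD : (f * D <= 1 / 12 * D)%R by rewrite ler_pM2r.
have up : m (ball y r) <= (al + J%:R * de)%:E.
  have boc := @ball_off_core_le al de a i y r (b y - r)%R J slab1 (ltW core_ai) (ltW de0).
  apply: boc => //.
  - have := ler_norm a; rewrite /s in by_ge; rewrite /r; lra.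
  - by rewrite subrK.
  - by lra.
  - have := ler_norm (- a); rewrite normrN /s /r /C in J_le by_le by_ge far py1 J_gt *; lra.
have low : (q * (c * D))%:E <= m (ball y r).
  have rD : (r <= 3 * D)%R by rewrite /r; lra.
  have := ball_volume_lower mmX cd Nk k1 growth y r0 rD.
  have -> : (r / (2 * (3 * D)) = f / 6)%R by rewrite /r; field; rewrite gt_eqF.
  apply: le_trans; rewrite EFinM; apply: lee_wpmul2l; first by rewrite lee_fin ltW.
  apply: (le_trans (lowD D D1le)); apply: le_measure_ball.
  by rewrite (metric_sym y); lra.
have := le_trans low up; rewrite lee_fin.
have -> : (q * (c * D) = 2 * (D * de))%R by rewrite /de; field.
have : (J%:R * de <= D * de)%R by rewrite ler_pM2r//; rewrite /r in J_le; lra.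
lra.
Qed.

End level_sets.

(** * Compactness of closed bounded sets *)

Section compactness.
Context {R : realType} {X : completePMetricType R}.
Implicit Types (A : set X) (s : seq X).

Definition finitely_covered A (e : R) := exists s : seq X, forall x, A x ->
  exists2 y, y \in s & ball y e x.

Lemma ultra_mem_cover (F : set_system X) (UF : UltraFilter F) (B : X -> set X) s :
  F [set x | exists2 y, y \in s & B y x] -> exists y, F (B y).
Proof.
elim: s => [|y s IH] Fs.
  have /filter_ex[x [y]] := Fs; by rewrite in_nil.
have [FB|FnB] := in_ultra_setVsetC (B y) UF; first by exists y.
apply: IH; apply: filterS (filterI FnB Fs) => x /= [nBx [z]].
by rewrite in_cons => /orP[/eqP-> /nBx//|zs Bz]; exists z.
Qed.

Lemma compact_of_finitely_covered A : closed A ->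
  (forall e, 0 < e -> finitely_covered A e) -> compact A.
Proof.
move=> clA covA; rewrite compact_ultra => F UF FA.
have cF : cauchy F.
  apply: cauchy_exP => e e0; have [s sA] := covA e e0.
  apply: (ultra_mem_cover UF (B := fun y => ball y e) (s := s)).
  exact: filterS FA.
have FL : F --> lim F by exact: cauchy_cvg.
exists (lim F); split => //; apply: clA => U /FL; rewrite nbhs_simpl => FU.
have FAU : F (A `&` U) by exact: filterI.
have /filter_ex[x [Ax Ux]] := FAU.
by exists x.
Qed.

(** A separated sequence of maximal length is a net. *)
Lemma finitely_covered_of_separated A (e : R) (M : nat) :
  (forall s, (forall x, x \in s -> A x) -> pairwise (fun x y => e <= mdist x y) s ->
     (size s <= M)%N) -> finitely_covered A e.
Proof.
move=> bound.
pose P n := `[< exists s, [/\ forall x, x \in s -> A x,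
   pairwise (fun x y => e <= mdist x y) s & size s = n] >].
have P0 : exists n, P n by exists 0%N; apply/asboolP; exists [::].
have PM n : P n -> (n <= M)%N by move=> /asboolP[s [sA sep <-]]; exact: bound.
have [n /asboolP[s [sA sep sn]] nmax] := ex_maxnP P0 PM.
exists s => x Ax; apply: contrapT => nx.
suff /nmax : P n.+1 by rewrite ltnn.
apply/asboolP; exists (x :: s); split; last by rewrite /= sn.
  by move=> z; rewrite in_cons => /orP[/eqP->|/sA].
rewrite /= sep andbT; apply/allP => y ys; rewrite leNgt; apply/negP => xy.
by apply: nx; exists y => //; rewrite ballEmdist/= metric_sym.
Qed.

End compactness.

Section conclusion.
Context {R : realType} {X : completePMetricType R}.
Variables (m : {measure set (borel X) -> \bar R}) (N : R) (k : nat) (p : X).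
Hypothesis mmX : is_metric_measure_space m.
Hypotheses (cd : CD0 m N) (Nk : (N <= k%:R)%R) (k1 : (1 < k)%N).
Hypothesis growth : linear_growth m p.
Local Open Scope ereal_scope.

Lemma separated_balls_measure (e c : R) (s : seq X) :
  pairwise (fun x y => e <= mdist x y)%R s ->
  (forall x, x \in s -> c%:E <= m (ball x (e / 2))) ->
  (0 <= c)%R ->
  ((size s)%:R * c)%:E <= m (\big[setU/set0]_(x <- s) ball x (e / 2)).
Proof.
move=> + + c0; elim: s => [|x s IH] /=; first by rewrite mul0r big_nil measure0.
move=> /andP[/allP xs sep] sc; rewrite big_cons.
have mU : measurable (\big[setU/set0]_(y <- s) ball y (e / 2) : set (borel X)).
  by apply: bigsetU_measurable => y _; exact: measurable_mball.
rewrite measureU//; last 2 first.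
- exact: measurable_mball.
- rewrite -subset0 => z [xz]; rewrite -bigcup_seq => -[y /= /xs xy].
  rewrite !ballEmdist/= in xz * => yz.
  by have := metric_triangle x z y; rewrite (metric_sym z y); lra.
rewrite -natr1 mulrDl mul1r addrC EFinD; apply: leeD.
  by apply: sc; rewrite mem_head.
by apply: IH => // y ys; apply: sc; rewrite in_cons ys orbT.
Qed.

(** The balls of radius [e / 2] around separated points are disjoint and have
    volume bounded below by [ball_volume_lower]. *)
Lemma ball_separated_bound (D e : R) : (0 < D)%R -> (0 < e)%R -> exists M : nat,
  forall s : seq X, (forall x, x \in s -> ball p D x) ->
    pairwise (fun x y => e <= mdist x y)%R s -> (size s <= M)%N.
Proof.
move=> D0 e0.
pose e' : R := Num.min (e / 2)%R D.
have e'0 : (0 < e')%R by rewrite lt_min D0 divr_gt0.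
pose mu := fine (m (ball p D)).
have bfin r : m (ball p r) \is a fin_num by rewrite ge0_fin_numE// (measure_ball_lty mmX).
have mu0 : (0 < mu)%R.
  by rewrite fine_gt0// (measure_ball_gt0 mmX)// (measure_ball_lty mmX).
pose c : R := ((e' / (2 * (2 * D))) ^+ k * mu)%R.
have c0 : (0 < c)%R by rewrite mulr_gt0// exprn_gt0// divr_gt0// !mulr_gt0.
pose V := fine (m (ball p (D + e))).
exists (Num.truncn (V / c)) => s sD sep.
have sc x : x \in s -> c%:E <= m (ball x (e / 2)).
  move=> /sD; rewrite ballEmdist/= => px.
  have e'D : (e' <= 2 * D)%R.
    by have : (e' <= D)%R; [rewrite ge_min lexx orbT|lra].
  apply: (@le_trans _ _ (m (ball x e'))); last first.
    by apply: le_measure_ball; rewrite mdistxx addr0 ge_min lexx.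
  apply: le_trans (ball_volume_lower mmX cd Nk k1 growth x e'0 e'D).
  rewrite /c EFinM (fineK (bfin D)); apply: lee_wpmul2l.
    by rewrite lee_fin exprn_ge0// divr_ge0 ?(ltW e'0)// !mulr_ge0// ltW.
  by apply: le_measure_ball; rewrite metric_sym; lra.
have := separated_balls_measure sep sc (ltW c0).
have : m (\big[setU/set0]_(x <- s) ball x (e / 2)) <= V%:E.
  rewrite /V fineK//; apply: le_measure; rewrite ?inE; try exact: measurable_mball.
    by apply: bigsetU_measurable => y _; exact: measurable_mball.
  rewrite -bigcup_seq => z [x /= /sD]; rewrite !ballEmdist/= => px xz.
  by have := metric_triangle p x z; lra.
move=> /[swap] /le_trans /[apply]; rewrite lee_fin -ler_pdivlMr//.
by rewrite truncn_ge_nat// divr_ge0 ?(ltW c0)// fine_ge0.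
Qed.

Lemma compact_closed_bounded (A : set X) : closed A -> metric_bounded A -> compact A.
Proof.
move=> clA [x0 [r Ar]]; apply: compact_of_finitely_covered => // e e0.
pose D : R := (`|r| + mdist p x0 + 1)%R.
have D0 : (0 < D)%R by rewrite ltr_wpDl// addr_ge0// mdist_ge0.
have [M bound] := ball_separated_bound D0 e0.
apply: (@finitely_covered_of_separated _ _ _ _ M) => s sA; apply: bound => x /sA /Ar.
rewrite !ballEmdist/= => x0x.
by have := metric_triangle p x0 x; have := ler_norm r; rewrite /D; lra.
Qed.

End conclusion.

Lemma closed_busemann_level (R : realType) (X : completePMetricType R)
  (gamma : R -> X) (r : R) : geodesic_ray gamma ->
  closed (busemann gamma @^-1` [set r]).
Proof.
move=> ray; rewrite -openC.
have -> : ~` (busemann gamma @^-1` [set r]) =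
    [set x | busemann gamma x < r] `|` [set x | - busemann gamma x < - r].
  apply/seteqP; split => x /=.
    by move=> /eqP; rewrite neq_lt ltrN2 => /orP[]; [left|right].
  by rewrite ltrN2 => -[|] h; apply/eqP; [rewrite lt_eqF|rewrite gt_eqF].
apply: openU; apply: lipschitz_lt_open => x y.
  exact: busemann_lipschitz.
by have := busemann_lipschitz ray y x; rewrite metric_sym; lra.
Qed.

Lemma diam_busemann_level_le (R : realType) (X : completePMetricType R)
    (gamma : R -> X) (a C r : R) : 0 <= r -> 0 <= a -> 0 <= C ->
  (forall x, mdist (gamma 0) x <= a * (`|busemann gamma x| + C)) ->
  (diam (busemann gamma @^-1` [set r]) <= (2 * (a * (r + C)))%:E)%E.
Proof.
move=> r0 a0 C0 far; apply: ge_ereal_sup => _ [->|[[x y] [/= xr yr] <-]].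
  by rewrite lee_fin mulr_ge0// mulr_ge0// addr_ge0.
rewrite lee_fin; have := far x; have := far y; rewrite xr yr ger0_norm//.
by have := metric_triangle x (gamma 0) y; rewrite (metric_sym x (gamma 0)); lra.
Qed.

Theorem theorem1p2 (R : realType) (X : completePMetricType R)
    (m : {measure set (borel X) -> \bar R}) (N : R) (gamma : R -> X) (V0 : R) :
  1 <= N ->
  is_RCD0 m N ->
  ~ compact [set: X] ->
  geodesic_ray gamma ->
  limf_esup (fun r : R => (m (ball (gamma 0%R) r) * (r^-1)%:E)%E) +oo = V0%:E ->
  (exists2 C0 : R, C0 <= 2 &
     (limf_esup (fun r : R =>
        (diam (busemann gamma @^-1` [set r]) * (r^-1)%:E)%E) +oo%R <= C0%:E)%E) /\
  (forall r : R, compact (busemann gamma @^-1` [set r])).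
Proof.
move=> N1 [mmX _ cd] _ ray limV.
have growth := limsup_linear_growth mmX limV.
pose k := (Num.truncn N).+2.
have Nk : N <= k%:R.
  apply: (le_trans (ltW (Num.Theory.truncnS_gt N))).
  by rewrite ler_nat.
have k1 : (1 < k)%N by [].
have far := mdist_le_busemann mmX cd Nk k1 ray growth.
split; last first.
  move=> r; apply: (compact_closed_bounded mmX cd Nk k1 growth).
    exact: closed_busemann_level.
  have [||C farC] := far (1 / 2); [lra|lra|].
  exists (gamma 0), (2 * (`|r| + C) + 1) => x /= xr.
  by have := farC x; rewrite xr ballEmdist/=; lra.
(* With [(1 - d / (1 + d))^-1 = 1 + d] the diameter at height [r] is at most
   [2 (1 + d) (r + C')], and [2 (1 + d) = 2 + e / 2]. *)
exists 2 => //; apply/lee_addgt0Pr => e e0.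
pose d : R := e / 4.
have d0 : 0 < d by rewrite divr_gt0.
have [||C farC] := far (d / (1 + d)).
- by rewrite divr_gt0// addr_gt0.
- by rewrite ltr_pdivrMr ?addr_gt0//; lra.
pose C' := Num.max 0 C.
have C'0 : 0 <= C' by rewrite le_max lexx.
have {}farC x : mdist (gamma 0) x <= (1 + d) * (`|busemann gamma x| + C').
  have := farC x.
  have -> : 1 - d / (1 + d) = (1 + d)^-1 by field; rewrite gt_eqF// addr_gt0.
  rewrite mulrC ler_pdivrMr ?addr_gt0// => /le_trans; apply.
  rewrite mulrC ler_pM2l ?addr_gt0// lerD2l le_max lexx orbT//.
pose r0 := 4 * (1 + d) * C' / e + 1.
have r0p : 0 < r0.
  by rewrite ltr_wpDl// divr_ge0 ?(ltW e0)// !mulr_ge0// addr_ge0// ltW.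
apply: (@le_trans _ _ (ereal_sup ((fun r : R =>
    (diam (busemann gamma @^-1` [set r]) * (r^-1)%:E)%E) @` [set r | r0 < r]))).
  apply: ereal_inf_lbound; exists [set r | r0 < r] => //.
  by apply: nbhs_pinfty_gt; rewrite num_real.
apply: ge_ereal_sup => _ [r /= r0r <-].
have rp : 0 < r by rewrite (lt_trans r0p).
rewrite lee_pdivrMr//.
apply: (le_trans (diam_busemann_level_le (ltW rp) _ C'0 farC)).
  by rewrite addr_ge0// ltW.
rewrite -EFinD -EFinM lee_fin.
have : 4 * (1 + d) * C' / e <= r by rewrite /r0 in r0r; lra.
rewrite ler_pdivrMr// => h.
have -> : (2 + e) * r = 2 * (1 + d) * r + r * e / 2 by rewrite /d; field.
lra.
Qed.
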